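(* The evolutions of a 3-level quantum system by either the decoherence model of massive particles, $L_M$, or the pure decoherence model, $L_P$ (both with $d=3$), define new products $\{\cdot,\cdot\}_\infty$ and $(\cdot,\cdot)_\infty$ on expectation value functions in the asymptotic limit $t\to\infty$ (the same for both models). The Poisson bracket of the coordinate functions $x_1,\dots,x_8$ is $$\{x_1,x_3\}_\infty=-x_2,\quad\{x_2,x_3\}_\infty=x_1,$$ $$\{x_4,x_3\}_\infty=-\tfrac12x_5,\quad\{x_5,x_3\}_\infty=\tfrac12x_4,\quad\{x_4,x_8\}_\infty=-\tfrac{\sqrt3}{2}x_5,\quad\{x_5,x_8\}_\infty=\tfrac{\sqrt3}{2}x_4,$$ $$\{x_6,x_3\}_\infty=\tfrac12x_7,\quad\{x_7,x_3\}_\infty=-\tfrac12x_6,\quad\{x_6,x_8\}_\infty=-\tfrac{\sqrt3}{2}x_7,\quad\{x_7,x_8\}_\infty=\tfrac{\sqrt3}{2}x_6,$$ and the Jordan bracket is $$(x_3,x_3)_\infty=\tfrac23+\tfrac1{\sqrt3}x_8,\quad(x_8,x_8)_\infty=\tfrac23-\tfrac1{\sqrt3}x_8,$$ $$(x_1,x_8)_\infty=\tfrac1{\sqrt3}x_1,\quad(x_2,x_8)_\infty=\tfrac1{\sqrt3}x_2,\quad(x_3,x_8)_\infty=\tfrac1{\sqrt3}x_3,\quad(x_j,x_8)_\infty=-\tfrac1{2\sqrt3}x_j\ (j=4,5,6,7),$$ $$(x_4,x_3)_\infty=\tfrac12x_4,\quad(x_5,x_3)_\infty=\tfrac12x_5,\quad(x_6,x_3)_\infty=-\tfrac12x_6,\quad(x_7,x_3)_\infty=-\tfrac12x_7,$$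 where products of coordinate functions not listed (up to skew-symmetry, respectively symmetry) vanish. The set $\mathcal{E}_{\mathcal{D}}$ of expectation value functions is a Lie-Jordan algebra with respect to these two products.
   Context: $\mathcal{O}=\mathrm{Herm}(\mathbb{C}^3)$ with $[[a,b]]=-\frac{i}{2}(ab-ba)$, $a\odot b=\frac12(ab+ba)$. $\mathcal{D}$ is the set of $3\times3$ density matrices, $e_a(\rho)=\mathrm{tr}(\rho a)$, $\mathcal{E}_{\mathcal{D}}=\{e_a:a\in\mathcal{O}\}$, and $x_j=e_{\lambda_j}$ with $\lambda_1,\dots,\lambda_8$ the standard Gell-Mann matrices. $\mathcal{E}_{\mathcal{D}}$ is spanned by $1=e_I,x_1,\dots,x_8$. Differential calculus on $\mathcal{D}$ is that of the affine hyperplane $\{\mathrm{tr}\,\xi=1\}$ of $\mathrm{Herm}(\mathbb{C}^3)$. $\Lambda_{\mathcal{D}}$, $R_{\mathcal{D}}$ are the $(2,0)$-tensor fields with $\Lambda_{\mathcal{D}}(\mathrm{d}e_a,\mathrm{d}e_b)=e_{[[a,b]]}$ and $R_{\mathcal{D}}(\mathrm{d}e_a,\mathrm{d}e_b)=e_{a\odot b}-e_ae_b$. For a Kossakowski-Lindblad operator $L$ with flow $\Phi^L_t=e^{tL}$, put $\Lambda_{\mathcal{D},t}=\Phi^L_{t*}\Lambda_{\mathcal{D}}$ and $R_{\mathcal{D},t}=\Phi^L_{t*}R_{\mathcal{D}}$ (push-forwards), with pointwise limits $\Lambda_{\mathcal{D},\infty}$, $R_{\mathcal{D},\infty}$ as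 $t\to\infty$. The limit products are $\{f,g\}_\infty=\Lambda_{\mathcal{D},\infty}(\mathrm{d}f,\mathrm{d}g)$ and $(f,g)_\infty=R_{\mathcal{D},\infty}(\mathrm{d}f,\mathrm{d}g)+fg$. Models, in an orthonormal basis $|1\rangle,\dots,|d\rangle$ of $\mathbb{C}^d$ with $P_l=|l\rangle\langle l|$: - Decoherence of massive particles, discretized to $d$ positions on a circle: $L_M(|m\rangle\langle n|)=-4\gamma\sin^2\!\left(\frac{\pi(m-n)}{d}\right)|m\rangle\langle n|$, $\gamma>0$. - Pure decoherence: $L_P(\rho)=-\frac1d\sum_{k=1}^{d-1}\gamma_k(\rho-U_k\rho U_k^* )$, $\gamma_k>0$, where $U_k=\sum_{l=1}^{d}\lambda^{-k(l-1)}P_l$ and $\lambda=e^{2\pi i/d}$. Here $d=3$ and the basis is the standard one in which the Gell-Mann matrices are written. A Lie-Jordan algebra is a real vector space with a Lie bracket $[[\cdot,\cdot]]$ and a Jordan product $\odot$ (symmetric bilinear with $(a\odot b)\odot(a\odot a)=a\odot(b\odot(a\odot a))$) such that each $[[a,\cdot]]$ is a derivation of $\odot$ and $a\odot(b\odot c)-(a\odot b)\odot c=\mu^2\left([[a,[[b,c]]]]-[[[[a,b]],c]]\right)$ for some real $\mu\ne0$. *)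

(* Defs.v *)
From HB Require Import structures.
From mathcomp Require Import all_boot all_order all_algebra.
From mathcomp Require Import complex.
From mathcomp Require Import all_classical all_reals all_analysis.
From mathcomp Require Import ring lra.

Set Implicit Arguments.
Unset Strict Implicit.
Unset Printing Implicit Defensive.

Import Order.TTheory GRing.Theory Num.Theory.
Import numFieldNormedType.Exports.

Local Open Scope classical_set_scope.
Local Open Scope ring_scope.
Local Open Scope complex_scope.
Local Open Scope sesquilinear_scope.

Section Products.
Variable (R : realType) (d : nat).

Definition lie (a b : 'M[R[i]]_d) : 'M[R[i]]_d :=
  (- ('i / 2)) *: (a *m b - b *m a).

Definition jordan (a b : 'M[R[i]]_d) : 'M[R[i]]_d :=
  2^-1 *: (a *m b + b *m a).

(* The real part only serves to land in R: the trace of a product of two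
   Hermitian matrices is real. *)
Definition ev (a xi : 'M[R[i]]_d) : R := complex.Re (\tr (xi *m a)).

End Products.

(* Indices of kets are 0-based here; the formulas of both models only involve
   differences of indices, or the index l - 1. *)
Section Models.
Variable (R : realType) (d : nat).

Definition L_M (gamma : R) (rho : 'M[R[i]]_d) : 'M[R[i]]_d :=
  \sum_(m < d) \sum_(n < d) rho m n *:
    ((- (4 * gamma * sin (pi * (m%:R - n%:R) / d%:R) ^+ 2))%:C *:
       delta_mx m n).

Definition lambda : R[i] :=
  cos (2 * pi / d%:R) +i* sin (2 * pi / d%:R).

Definition U (k : nat) : 'M[R[i]]_d :=
  \sum_(l < d) lambda ^- (k * l) *: delta_mx l l.

Definition L_P (gamma : nat -> R) (rho : 'M[R[i]]_d) : 'M[R[i]]_d :=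
  (- d%:R^-1) *:
    \sum_(1 <= k < d) (gamma k)%:C *: (rho - U k *m rho *m (U k)^t*).

End Models.

Section Flow.
Variable (R : realType) (d : nat).

Definition limC (u : nat -> R[i]) : R[i] :=
  lim ((fun n => complex.Re (u n)) @ \oo) +i*
  lim ((fun n => complex.Im (u n)) @ \oo).

Definition flow_term (L : 'M[R[i]]_d -> 'M[R[i]]_d) (t : R)
    (rho : 'M[R[i]]_d) (k : nat) : 'M[R[i]]_d :=
  (t ^+ k / k`!%:R)%:C *: iter k L rho.

(* e^{tL}, the exponential series being summed entrywise. *)
Definition flow (L : 'M[R[i]]_d -> 'M[R[i]]_d) (t : R)
    (rho : 'M[R[i]]_d) : 'M[R[i]]_d :=
  \matrix_(i, j) limC (fun n => (\sum_(k < n) flow_term L t rho k) i j).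

End Flow.

Section Qutrit.
Variable R : realType.
Notation V := 'M[R[i]]_3.

Definition mx3 (s : seq (seq R[i])) : V :=
  \matrix_(i < 3, j < 3) nth 0 (nth [::] s i) j.

Definition gellmann (j : nat) : V :=
  match j with
  | 1%N => mx3 [:: [:: 0; 1; 0]; [:: 1; 0; 0]; [:: 0; 0; 0]]
  | 2%N => mx3 [:: [:: 0; - 'i; 0]; [:: 'i; 0; 0]; [:: 0; 0; 0]]
  | 3%N => mx3 [:: [:: 1; 0; 0]; [:: 0; -1; 0]; [:: 0; 0; 0]]
  | 4%N => mx3 [:: [:: 0; 0; 1]; [:: 0; 0; 0]; [:: 1; 0; 0]]
  | 5%N => mx3 [:: [:: 0; 0; - 'i]; [:: 0; 0; 0]; [:: 'i; 0; 0]]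
  | 6%N => mx3 [:: [:: 0; 0; 0]; [:: 0; 0; 1]; [:: 0; 1; 0]]
  | 7%N => mx3 [:: [:: 0; 0; 0]; [:: 0; 0; - 'i]; [:: 0; 'i; 0]]
  | 8%N => ((Num.sqrt 3)^-1)%:C *:
           mx3 [:: [:: 1; 0; 0]; [:: 0; 1; 0]; [:: 0; 0; -2]]
  | _ => 0
  end.

Definition is_density (rho : V) : Prop :=
  [/\ rho \is hermsymmx,
      forall v : 'cV[R[i]]_3, 0 <= (v^t* *m rho *m v) 0 0
    & \tr rho = 1].

Record density := Density {
  density_mx :> V;
  densityP : is_density density_mx }.

Definition hyperplane : set V :=
  [set xi | xi \is hermsymmx /\ \tr xi = 1].

Definition expect (a : V) : density -> R := fun rho => ev a rho.

Definition expectations : set (density -> R) :=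
  [set expect a | a in [set a : V | a \is hermsymmx]].

Definition xcoord (j : nat) : density -> R := expect (gellmann j).

(* The tangent spaces of the hyperplane consist of the traceless Hermitian
   matrices.  A covector is represented by a real-linear form on the ambient
   space, of which only the restriction to those matrices matters; thus the
   differential of e_a is represented, at every point, by ev a itself. *)
Definition real_linear (alpha : V -> R) : Prop :=
  forall (k : R) (u v : V),
    alpha (k%:C *: u + v) = k * alpha u + alpha v.

(* The Hilbert-Schmidt norm, on Hermitian matrices. *)
Definition hsnorm (v : V) : R := Num.sqrt (ev v v).

(* Frechet differentiability relative to the convex body of density matrices,
   which has nonempty interior in the hyperplane; hence alpha is unique on
   traceless Hermitian matrices, also at boundary points. *)
Definition is_differential (f : density -> R) (rho : density)
    (alpha : V -> R) : Prop :=
  real_linear alpha /\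
  forall eps : R, 0 < eps -> exists2 delta : R, 0 < delta &
    forall sigma : density,
      hsnorm (density_mx sigma - density_mx rho) < delta ->
      `|f sigma - f rho - alpha (density_mx sigma - density_mx rho)| <=
        eps * hsnorm (density_mx sigma - density_mx rho).

Definition differential (f : density -> R) (rho : density) : V -> R :=
  xget (fun=> 0) [set alpha | is_differential f rho alpha].

(* (2,0)-tensor fields on the hyperplane. *)
Definition tensor_field := V -> (V -> R) -> (V -> R) -> R.

(* The traceless Hermitian matrix a such that alpha = ev a on traceless
   Hermitian matrices, since \tr (gellmann j *m gellmann k) = 2 delta_jk. *)
Definition sharp (alpha : V -> R) : V :=
  2^-1 *: \sum_(1 <= j < 9) (alpha (gellmann j))%:C *: gellmann j.

(* See LambdaD_ev and RD_ev below for the defining properties. *)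
Definition LambdaD : tensor_field := fun xi alpha beta =>
  ev (lie (sharp alpha) (sharp beta)) xi.

Definition RD : tensor_field := fun xi alpha beta =>
  ev (jordan (sharp alpha) (sharp beta)) xi -
  ev (sharp alpha) xi * ev (sharp beta) xi.

(* Push-forward by the linear isomorphism e^{tL}, with inverse e^{-tL}. *)
Definition pushforward (L : V -> V) (t : R) (T : tensor_field) :
    tensor_field := fun xi alpha beta =>
  T (flow L (- t) xi) (alpha \o flow L t) (beta \o flow L t).

Definition limit_field (L : V -> V) (T : tensor_field) : tensor_field :=
  fun xi alpha beta => lim (pushforward L t T xi alpha beta @[t --> +oo]).

Definition limit_exists (L : V -> V) (T : tensor_field) : Prop :=
  forall (xi : V) (alpha beta : V -> R),
    hyperplane xi -> real_linear alpha -> real_linear beta ->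
    cvg (pushforward L t T xi alpha beta @[t --> +oo]).

Definition poisson_oo (L : V -> V) (f g : density -> R) : density -> R :=
  fun rho =>
    limit_field L LambdaD rho (differential f rho) (differential g rho).

Definition jordan_oo (L : V -> V) (f g : density -> R) : density -> R :=
  fun rho =>
    limit_field L RD rho (differential f rho) (differential g rho)
    + f rho * g rho.

Definition poisson_listed (j k : nat) : option (density -> R) :=
  match j, k with
  | 1%N, 3%N => Some (- xcoord 2)
  | 2%N, 3%N => Some (xcoord 1)
  | 4%N, 3%N => Some (- 2^-1 *: xcoord 5)
  | 5%N, 3%N => Some (2^-1 *: xcoord 4)
  | 4%N, 8%N => Some (- (Num.sqrt 3 / 2) *: xcoord 5)
  | 5%N, 8%N => Some (Num.sqrt 3 / 2 *: xcoord 4)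
  | 6%N, 3%N => Some (2^-1 *: xcoord 7)
  | 7%N, 3%N => Some (- 2^-1 *: xcoord 6)
  | 6%N, 8%N => Some (- (Num.sqrt 3 / 2) *: xcoord 7)
  | 7%N, 8%N => Some (Num.sqrt 3 / 2 *: xcoord 6)
  | _, _ => None
  end.

Definition poisson_table (j k : nat) : density -> R :=
  match poisson_listed j k, poisson_listed k j with
  | Some f, _ => f
  | None, Some f => - f
  | None, None => 0
  end.

Definition jordan_listed (j k : nat) : option (density -> R) :=
  match j, k with
  | 3%N, 3%N => Some (cst (2 / 3) + (Num.sqrt 3)^-1 *: xcoord 8)
  | 8%N, 8%N => Some (cst (2 / 3) - (Num.sqrt 3)^-1 *: xcoord 8)
  | 1%N, 8%N => Some ((Num.sqrt 3)^-1 *: xcoord 1)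
  | 2%N, 8%N => Some ((Num.sqrt 3)^-1 *: xcoord 2)
  | 3%N, 8%N => Some ((Num.sqrt 3)^-1 *: xcoord 3)
  | 4%N, 8%N => Some (- (2 * Num.sqrt 3)^-1 *: xcoord 4)
  | 5%N, 8%N => Some (- (2 * Num.sqrt 3)^-1 *: xcoord 5)
  | 6%N, 8%N => Some (- (2 * Num.sqrt 3)^-1 *: xcoord 6)
  | 7%N, 8%N => Some (- (2 * Num.sqrt 3)^-1 *: xcoord 7)
  | 4%N, 3%N => Some (2^-1 *: xcoord 4)
  | 5%N, 3%N => Some (2^-1 *: xcoord 5)
  | 6%N, 3%N => Some (- 2^-1 *: xcoord 6)
  | 7%N, 3%N => Some (- 2^-1 *: xcoord 7)
  | _, _ => None
  end.

Definition jordan_table (j k : nat) : density -> R :=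
  match jordan_listed j k, jordan_listed k j with
  | Some f, _ => f
  | None, Some f => f
  | None, None => 0
  end.

End Qutrit.

(* A linear subspace E of W which is a Lie-Jordan algebra for the operations
   br and jo; these are only constrained on E. *)
Record is_lie_jordan (R : realType) (W : lmodType R) (E : set W)
    (br jo : W -> W -> W) : Prop := IsLieJordan {
  lj_zero : E 0;
  lj_lin : forall (k : R) a b, E a -> E b -> E (k *: a + b);
  lj_br_closed : forall a b, E a -> E b -> E (br a b);
  lj_jo_closed : forall a b, E a -> E b -> E (jo a b);
  lj_br_linl : forall (k : R) a b c, E a -> E b -> E c ->
    br (k *: a + b) c = k *: br a c + br b c;
  lj_br_skew : forall a b, E a -> E b -> br b a = - br a b;
  lj_jacobi : forall a b c, E a -> E b -> E c ->
    br a (br b c) + br b (br c a) + br c (br a b) = 0;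
  lj_jo_linl : forall (k : R) a b c, E a -> E b -> E c ->
    jo (k *: a + b) c = k *: jo a c + jo b c;
  lj_jo_sym : forall a b, E a -> E b -> jo b a = jo a b;
  lj_jordan : forall a b, E a -> E b ->
    jo (jo a b) (jo a a) = jo a (jo b (jo a a));
  lj_derivation : forall a b c, E a -> E b -> E c ->
    br a (jo b c) = jo (br a b) c + jo b (br a c);
  lj_associator : exists2 mu : R, mu != 0 &
    forall a b c, E a -> E b -> E c ->
      jo a (jo b c) - jo (jo a b) c =
      mu ^+ 2 *: (br a (br b c) - br (br a b) c) }.

Section DefiningProperties.
Variable R : realType.
Notation V := 'M[R[i]]_3.

Lemma hermE (a : V) i j : a \is hermsymmx -> a i j = conjc (a j i).
Proof. by move=> /is_hermitianmxP {1}->; rewrite expr0 scale1r !mxE. Qed.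

Lemma mx3E (s : seq (seq R[i])) (i j : 'I_3) :
  mx3 s i j = nth 0 (nth [::] s i) j.
Proof. by rewrite mxE. Qed.

Lemma ord3P (P : 'I_3 -> Prop) :
  P (@Ordinal 3 0 isT) -> P (@Ordinal 3 1 isT) -> P (@Ordinal 3 2 isT) ->
  forall i, P i.
Proof.
by move=> h0 h1 h2 [[|[|[|//]]] hi]; [move: h0|move: h1|move: h2];
  congr (P _); apply: val_inj.
Qed.

Lemma sum3 (F : 'I_3 -> R[i]) : \sum_i F i =
  F (@Ordinal 3 0 isT) + F (@Ordinal 3 1 isT) + F (@Ordinal 3 2 isT).
Proof.
rewrite !big_ord_recl big_ord0 addr0 addrA.
by congr (F _ + F _ + F _); apply: val_inj.
Qed.

Notation o0 := (@Ordinal 3 0 isT).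
Notation o1 := (@Ordinal 3 1 isT).
Notation o2 := (@Ordinal 3 2 isT).

Lemma tr_mx3 (s : seq (seq R[i])) (a : V) : \tr (mx3 s *m a) =
  let e i j := nth 0 (nth [::] s i) j in
   (e 0 0 * a o0 o0 + e 0 1 * a o1 o0 + e 0 2 * a o2 o0) +
   (e 1 0 * a o0 o1 + e 1 1 * a o1 o1 + e 1 2 * a o2 o1) +
   (e 2 0 * a o0 o2 + e 2 1 * a o1 o2 + e 2 2 * a o2 o2).
Proof.
by rewrite /mxtrace sum3 !mxE !sum3 !mxE.
Qed.

Lemma herm_coords (a : V) : a \is hermsymmx ->
  exists p q r u1 v1 u2 v2 u3 v3 : R,
  a = mx3 [:: [:: p +i* 0; u1 +i* v1; u2 +i* v2];
              [:: u1 +i* - v1; q +i* 0; u3 +i* v3];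
              [:: u2 +i* - v2; u3 +i* - v3; r +i* 0] ].
Proof.
move=> ha; have H i j := @hermE a i j ha.
exists (complex.Re (a o0 o0)), (complex.Re (a o1 o1)), (complex.Re (a o2 o2)).
exists (complex.Re (a o0 o1)), (complex.Im (a o0 o1)).
exists (complex.Re (a o0 o2)), (complex.Im (a o0 o2)).
exists (complex.Re (a o1 o2)), (complex.Im (a o1 o2)).
have D (z : R[i]) : z = conjc z -> z = complex.Re z +i* 0.
  by case: z => p q [] e; congr (_ +i* _) => /=; lra.
apply/matrixP => i j; rewrite mx3E; elim/ord3P: i; elim/ord3P: j => /=;
 try exact: D; rewrite ?(H o1 o0) ?(H o2 o0) ?(H o2 o1); by case: (a _ _).
Qed.

Lemma sharp_ev (a : V) : a \is hermsymmx ->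
  sharp (ev a) = a - (\tr a / 3)%:M.
Proof.
move=> /herm_coords[p [q [r [u1 [v1 [u2 [v2 [u3 [v3 ->]]]]]]]]].
set b := mx3 _.
have s3 : (Num.sqrt 3 : R)^-1 * (Num.sqrt 3)^-1 = 3^-1.
  by rewrite -invfM -expr2 sqr_sqrtr.
have E8 : ev b (gellmann R 8) = (Num.sqrt 3)^-1 * (p + q - 2 * r).
  rewrite /ev /gellmann -scalemxAl mxtraceZ tr_mx3 !mx3E /=.
  simpc => /=; ring.
have E1 : ev b (gellmann R 1) = 2 * u1.
  by rewrite /ev /gellmann tr_mx3 !mx3E /=; simpc => /=; ring.
have E2 : ev b (gellmann R 2) = - 2 * v1.
  by rewrite /ev /gellmann tr_mx3 !mx3E /=; simpc => /=; ring.
have E3 : ev b (gellmann R 3) = p - q.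
  by rewrite /ev /gellmann tr_mx3 !mx3E /=; simpc => /=; ring.
have E4 : ev b (gellmann R 4) = 2 * u2.
  by rewrite /ev /gellmann tr_mx3 !mx3E /=; simpc => /=; ring.
have E5 : ev b (gellmann R 5) = - 2 * v2.
  by rewrite /ev /gellmann tr_mx3 !mx3E /=; simpc => /=; ring.
have E6 : ev b (gellmann R 6) = 2 * u3.
  by rewrite /ev /gellmann tr_mx3 !mx3E /=; simpc => /=; ring.
have E7 : ev b (gellmann R 7) = - 2 * v3.
  by rewrite /ev /gellmann tr_mx3 !mx3E /=; simpc => /=; ring.
have -> : \tr b = (p + q + r)%:C.
  by rewrite /mxtrace sum3 !mx3E /=; simpc.
rewrite /sharp -[index_iota 1 9]/[:: 1; 2; 3; 4; 5; 6; 7; 8]%N !big_cons big_nil.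
rewrite E1 E2 E3 E4 E5 E6 E7 E8 /gellmann scalerA.
have -> : ((Num.sqrt 3)^-1 * (p + q - 2 * r))%:C * (Num.sqrt 3)^-1%:C =
   ((p + q - 2 * r) / 3)%:C :> R[i].
  rewrite -rmorphM; congr (_%:C); rewrite -s3; ring.
have i2 : (2^-1 : R[i]) = (2^-1)%:C by rewrite fmorphV rmorph_nat.
have i3 : (3^-1 : R[i]) = (3^-1)%:C by rewrite fmorphV rmorph_nat.
rewrite i2 i3 addr0 /b {E1 E2 E3 E4 E5 E6 E7 E8 s3 b i2 i3}.
have mxA (M N : V) i j : (M + N) i j = M i j + N i j by rewrite mxE.
have mxZ k (M : V) i j : (k *: M) i j = k * M i j by rewrite mxE.
have mxN (M : V) i j : (- M) i j = - M i j by rewrite mxE.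
apply/matrixP => i j; rewrite !(mxA, mxZ, mxN, mx3E) [_%:M i j]mxE.
elim/ord3P: i; elim/ord3P: j => /=; 
  rewrite ?(mulr0, mulr1, mulr0n, add0r, addr0); simpc; congr (_ +i* _); lra.
Qed.

Lemma lie_shift d (a b : 'M[R[i]]_d) (s t : R[i]) :
  lie (a - s%:M) (b - t%:M) = lie a b.
Proof.
rewrite /lie; congr (_ *: _).
rewrite !(mulmxBl, mulmxBr) !mul_scalar_mx !mul_mx_scalar.
rewrite !scale_scalar_mx (mulrC t s).
set u := _ *m _; set v := _ *m _.
rewrite !opprB !addrA.
apply/matrixP => i j; rewrite !mxE; ring.
Qed.

Lemma LambdaD_ev (a b xi : V) :
  a \is hermsymmx -> b \is hermsymmx -> hyperplane xi ->
  LambdaD xi (ev a) (ev b) = ev (lie a b) xi.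
Proof. by move=> ha hb _; rewrite /LambdaD (sharp_ev ha) (sharp_ev hb) lie_shift. Qed.

Lemma evB (a b xi : V) : ev (a - b) xi = ev a xi - ev b xi.
Proof. by rewrite /ev mulmxBr linearB /= raddfB. Qed.

Lemma ev_scalar (s : R) (xi : V) : \tr xi = 1 -> ev s%:C%:M xi = s.
Proof. by move=> h; rewrite /ev mul_mx_scalar mxtraceZ h mulr1. Qed.

Lemma herm_tr (a : V) : a \is hermsymmx -> \tr a = (complex.Re (\tr a))%:C.
Proof.
move=> /herm_coords[p [q [r [u1 [v1 [u2 [v2 [u3 [v3 ->]]]]]]]]].
by rewrite /mxtrace sum3 !mx3E /=; simpc.
Qed.

Lemma ev_jordan_shift (a b xi : V) (s t : R) : \tr xi = 1 ->
  ev (jordan (a - s%:C%:M) (b - t%:C%:M)) xi =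
  ev (jordan a b) xi - s * ev b xi - t * ev a xi + s * t.
Proof.
move=> h.
have -> : jordan (a - s%:C%:M) (b - t%:C%:M) =
   jordan a b - s%:C *: b - t%:C *: a - (- (s * t))%:C%:M.
  rewrite /jordan !(mulmxBl, mulmxBr) !mul_scalar_mx !mul_mx_scalar.
  rewrite !scale_scalar_mx.
  move: (a *m b) (b *m a) => ab ba.
  apply/matrixP => i j; rewrite !mxE !rmorphN !rmorphM /=.
  move: (a i j) (b i j) (ab i j) (ba i j) s%:C t%:C => c1 c2 c3 c4 c5 c6.
  by case: (i == j); rewrite ?mulr1n ?mulr0n; field.
have evZ k c : ev (k%:C *: c) xi = k * ev c xi.
  rewrite /ev -scalemxAr mxtraceZ; case: (\tr _) => ? ?.
  by simpc.
by rewrite !evB !evZ ev_scalar // opprK.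
Qed.

Lemma RD_ev (a b xi : V) :
  a \is hermsymmx -> b \is hermsymmx -> hyperplane xi ->
  RD xi (ev a) (ev b) = ev (jordan a b) xi - ev a xi * ev b xi.
Proof.
move=> ha hb [_ h]; rewrite /RD (sharp_ev ha) (sharp_ev hb) (herm_tr ha) (herm_tr hb).
have i3 : (3^-1 : R[i]) = (3^-1)%:C by rewrite fmorphV rmorph_nat.
rewrite !i3 -!rmorphM /=; rewrite ev_jordan_shift // !evB !ev_scalar //.
move: (complex.Re (\tr a) * _) (complex.Re (\tr b) * _) => s t.
move: (ev (jordan a b) xi) (ev a xi) (ev b xi) => A B C; ring.
Qed.

End DefiningProperties.

(* Main.v *)
(* Both generators multiply the matrix entry (i, j) by a number nu i j which
   vanishes for i = j and has, for i <> j, a real part - kappa < 0 independent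
   of (i, j), with nu j i = conj (nu i j).  Hence e^{tL} multiplies the entries
   by e^{t nu i j}, and the push-forwards replace the matrix product by
   e^{t (nu j i + nu k j - nu k i)} a i j b j k, summed over j.  The exponent
   vanishes when i = j or j = k and has real part at most - kappa otherwise, so
   in the limit only the products with a diagonal factor survive.  This limit
   product makes 'M_3 the square-zero extension of the diagonal matrices by the
   bimodule of off-diagonal ones, an associative *-algebra; its commutator and
   anticommutator on Hermitian matrices give the limit products, whence the
   Lie-Jordan axioms with mu = 1, for both models alike. *)
Require Import Defs.
From HB Require Import structures.
From mathcomp Require Import all_boot all_order all_algebra.
From mathcomp Require Import complex.
From mathcomp Require Import all_classical all_reals all_analysis.
From mathcomp Require Import ring lra.
Set Implicit Arguments.
Unset Strict Implicit.
Unset Printing Implicit Defensive.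
Import Order.TTheory GRing.Theory Num.Theory.
Import numFieldNormedType.Exports.
Local Open Scope classical_set_scope.
Local Open Scope ring_scope.
Local Open Scope complex_scope.

(** * The exponential of an entrywise multiplier *)

Section ComplexExponential.
Variable R : realType.
Implicit Types (z w : R[i]) (t : R).

(** The complex exponential in real and imaginary parts; its agreement with the power series is the
    content of [limC_exp]. *)
Definition cexp z : R[i] :=
  (expR (complex.Re z) * cos (complex.Im z)) +i*
  (expR (complex.Re z) * sin (complex.Im z)).

Lemma cexp0 : cexp 0 = 1.
Proof. by rewrite /cexp /= expR0 cos0 sin0 mul1r mulr0. Qed.

Lemma cexpD z w : cexp (z + w) = cexp z * cexp w.
Proof.
case: z w => [x y] [u v]; rewrite /cexp /=; simpc => /=.
by rewrite expRD cosD sinD; congr (_ +i* _); ring.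
Qed.

Lemma cexpJ z : cexp (conjc z) = conjc (cexp z).
Proof. by case: z => x y; rewrite /cexp /= cosN sinN mulrN. Qed.

(** A real-valued submultiplicative norm, enough to dominate the exponential series. *)
Definition norm1c z : R := `|complex.Re z| + `|complex.Im z|.

Lemma norm1cM z w : norm1c (z * w) <= norm1c z * norm1c w.
Proof.
case: z w => [x y] [u v]; rewrite /norm1c /=.
have h1 := ler_normB (x * u) (y * v); have h2 := ler_normD (x * v) (y * u).
apply: le_trans (lerD h1 h2) _; rewrite !normrM mulrDl !mulrDr.
by rewrite le_eqVlt; apply/orP; left; apply/eqP; ring.
Qed.

Lemma norm1cX z n : norm1c (z ^+ n) <= norm1c z ^+ n.
Proof.
elim: n => [|n IH]; first by rewrite !expr0 /norm1c /= normr0 normr1 addr0.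
rewrite !exprS; apply: le_trans (norm1cM _ _) _.
by apply: ler_wpM2l => //; rewrite addr_ge0.
Qed.

(** Taylor coefficients in [t] of the real part of [z e^{tw}]. The prefactor [z] makes the family
    stable under differentiation, and [z = - i] gives access to the imaginary part. *)
Definition Re_exp_coeff z w : R^nat :=
  fun k => complex.Re (z * w ^+ k) / k`!%:R.

(** Comparison with [norm1c z] times the exponential series at [norm1c w * |t|]. *)
Lemma is_cvg_Re_exp z w t : cvgn (pseries (Re_exp_coeff z w) t).
Proof.
apply: normed_cvg; apply: (@series_le_cvg _ _
  (fun k => norm1c z * exp_coeff (norm1c w * `|t|) k)) => [k|k|k|].
- by rewrite normr_ge0.
- by rewrite mulr_ge0 ?addr_ge0 // exp_coeff_ge0 // mulr_ge0 ?addr_ge0.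
- rewrite /Re_exp_coeff /= exp_coeffE !normrM normfV [`|k`!%:R|]ger0_norm //.
  rewrite normrX exprMn [_^-1 * _]mulrC !mulrA [_ / _ * _]mulrAC.
  apply: ler_wpM2r; first by rewrite invr_ge0.
  apply: ler_wpM2r; first by rewrite exprn_ge0.
  apply: (@le_trans _ _ (norm1c (z * w ^+ k))); first by rewrite lerDl.
  apply: le_trans (norm1cM _ _) _.
  by apply: ler_wpM2l; [rewrite addr_ge0|exact: norm1cX].
by apply: is_cvg_seriesZ; exact: is_cvg_series_exp_coeff.
Qed.

Lemma pseries_diffs_Re_exp z w :
  pseries_diffs (Re_exp_coeff z w) = Re_exp_coeff (z * w) w.
Proof.
apply/funext => k; rewrite /pseries_diffs /Re_exp_coeff factS natrM exprS mulrA.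
by rewrite invfM mulrCA mulVKf.
Qed.

Definition Re_exp z w t : R := limn (pseries (Re_exp_coeff z w) t).

Lemma is_derive_Re_exp z w t :
  is_derive t (1 : R) (Re_exp z w) (Re_exp (z * w) w t).
Proof.
rewrite /Re_exp -pseries_diffs_Re_exp.
(* The series converge everywhere, so any radius beyond [|t|] serves. *)
apply: (@pseries_snd_diffs _ _ (`|t| + 1)); rewrite ?pseries_diffs_Re_exp;
  try exact: is_cvg_Re_exp.
by rewrite [ltRHS]ger0_norm ?addr_ge0 // ltrDl.
Qed.

Lemma Re_exp_lin z w u (x y : R) t :
  Re_exp (x%:C * z + y%:C * u) w t = x * Re_exp z w t + y * Re_exp u w t.
Proof.
rewrite /Re_exp.
rewrite [pseries _ _](_ : _ =
    x *: pseries (Re_exp_coeff z w) t + y *: pseries (Re_exp_coeff u w) t).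
  rewrite limD; try (apply: is_cvgZl_tmp; exact: is_cvg_Re_exp).
  by rewrite !limZl_tmp //; exact: is_cvg_Re_exp.
apply/funext => n; rewrite !fctE /pseries /series /= !scaler_sumr -big_split /=.
apply: eq_bigr => k _; rewrite /Re_exp_coeff.
rewrite mulrDl -!mulrA; move: (z * _) (u * _) => [a b] [c d] /=.
by rewrite /GRing.scale /=; ring.
Qed.

Lemma Re_exp0 z w : Re_exp z w 0 = complex.Re z.
Proof.
(* The partial sums are constant only from [n = 1] on; the one at [n = 0] is empty. *)
apply: lim_near_cst => //; near=> n; rewrite -[n]prednK; last by near: n.
rewrite /pseries /series /= big_nat_recl //= big1 ?addr0.
  by rewrite /Re_exp_coeff !expr0 fact0 divr1 !mulr1.
by move=> k _; rewrite expr0n mulr0.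
Unshelve. all: by end_near. Qed.

(* Multiplying by e^{- t Re w} and rotating by - t Im w turns Re_exp z w and
   Re_exp (i z) w into functions with zero derivative. *)
Lemma Re_expE z w t : Re_exp z w t = complex.Re (z * cexp (t%:C * w)).
Proof.
case: w => x y; pose w := x +i* y; rewrite -/w.
have zw : x%:C * z + y%:C * (z * 'i) = z * w.
  by case: z => a b; rewrite /w; simpc => /=; congr (_ +i* _); ring.
have ziw : x%:C * (z * 'i) + (- y)%:C * z = z * 'i * w.
  by case: z {zw} => a b; rewrite /w; simpc => /=; congr (_ +i* _); ring.
pose C := Re_exp z w; pose D := Re_exp (z * 'i) w.
have dC s : is_derive s (1 : R) C (x * C s + y * D s).
  rewrite -Re_exp_lin zw.
  exact: is_derive_Re_exp.
have dD s : is_derive s (1 : R) D (x * D s + - y * C s).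
  rewrite -Re_exp_lin ziw.
  exact: is_derive_Re_exp.
pose f s := expR (s * (- x)) * (C s * cos (s * y) - D s * sin (s * y)).
pose g s := expR (s * (- x)) * (C s * sin (s * y) + D s * cos (s * y)).
have f0 : f t = f 0.
  apply: is_derive_0_is_cst => s; apply: trigger_derive.
  by rewrite /GRing.scale /=; ring.
have g0 : g t = g 0.
  apply: is_derive_0_is_cst => s; apply: trigger_derive.
  by rewrite /GRing.scale /=; ring.
move: f0 g0; rewrite /f /g !mul0r expR0 cos0 sin0 /C /D !Re_exp0.
rewrite -/C -/D !mul1r !mulr0 !mulr1 subr0 add0r.
have -> : cexp (t%:C * w) = (expR (t * x) * cos (t * y)) +i*
   (expR (t * x) * sin (t * y)).
  by rewrite /cexp /=; simpc.
rewrite mulrN => f0 g0; have e1 := expRxMexpNx_1 (t * x).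
have e2 := cos2Dsin2 (t * y); 
move: (C t) (D t) f0 g0 => {dC dD f g C D zw ziw} c d.
move: (expR (t * x)) (expR (- (t * x))) (cos (t * y)) (sin (t * y)) e1 e2.
move=> e e' k s e1 e2.
case: z => a b /=; simpc => <- g0.
have {}g0 : - b = e' * (c * s + d * k) by rewrite g0; ring.
(* Undoing the scaling and the rotation expresses [c] through the two conserved quantities. *)
transitivity ((e * e') * (k ^+ 2 + s ^+ 2) * c); first by rewrite e1 e2 !mul1r.
transitivity (e' * (c * k - d * s) * (e * k) + (- b) * (e * s)); last by ring.
by rewrite g0; ring.
Qed.

Lemma Im_ReN z : complex.Im z = complex.Re (z * - 'i).
Proof. by case: z => a b /=; ring. Qed.

(** By [Im_ReN] the imaginary part is a real part after multiplication by [- i], so both component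
    limits are instances of [Re_expE]. *)
Lemma limC_exp z w t :
  limC (fun n => \sum_(k < n) (t ^+ k / k`!%:R)%:C * (w ^+ k * z)) =
  cexp (t%:C * w) * z.
Proof.
have H u : limn (fun n => complex.Re (u *
    \sum_(k < n) (t ^+ k / k`!%:R)%:C * (w ^+ k * z))) =
    complex.Re (u * (cexp (t%:C * w) * z)).
  rewrite [u * (cexp _ * z)]mulrCA mulrC -Re_expE /Re_exp.
  congr (lim (_ @ \oo)).
  apply/funext => n; rewrite /pseries /series /= big_mkord mulr_sumr raddf_sum.
  apply: eq_bigr => k _; rewrite /Re_exp_coeff mulrCA [w ^+ k * z]mulrC.
  rewrite -[u * z * _]mulrA.
  by move: (u * (z * w ^+ k)) => [a b] /=; ring.
rewrite /limC; set S := (X in limn (fun n => complex.Re (X n))).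
transitivity (complex.Re (1 * (cexp (t%:C * w) * z)) +i*
   complex.Re (- 'i * (cexp (t%:C * w) * z))).
  rewrite -!H; congr (_ +i* _); congr (lim (_ @ \oo)); apply/funext => n.
    by rewrite mul1r.
  by rewrite Im_ReN mulrC.
by rewrite mul1r [- 'i * _]mulrC -Im_ReN; case: (_ * _).
Qed.

End ComplexExponential.

(** * The flow of a generator that acts entrywise *)

Section Multipliers.
Variables (R : realType) (d : nat) (nu : 'I_d -> 'I_d -> R[i]).
Variable L : 'M[R[i]]_d -> 'M[R[i]]_d.
Hypothesis LE : forall rho i j, L rho i j = nu i j * rho i j.

Lemma flowE t rho i j : flow L t rho i j = cexp (t%:C * nu i j) * rho i j.
Proof.
rewrite mxE -limC_exp; congr limC; apply/funext => n; rewrite summxE.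
apply: eq_bigr => k _; rewrite mxE; congr (_ * _).
elim: (nat_of_ord k) => [|m IH] /=; first by rewrite expr0 mul1r.
by rewrite LE IH exprS mulrA.
Qed.

End Multipliers.

(** * The limit product of matrices *)

Section ComplexLimits.
Variable R : realType.
Implicit Types (u v : R -> R[i]) (l z : R[i]).

(** Convergence by components, since the tensor fields are real parts of complex traces. *)
Definition ccvg u l :=
  complex.Re (u t) @[t --> +oo] --> complex.Re l /\
  complex.Im (u t) @[t --> +oo] --> complex.Im l.

Lemma ccvg_cst l : ccvg (fun=> l) l.
Proof. by split; exact: cvg_cst. Qed.

Lemma ccvgD u v l m : ccvg u l -> ccvg v m -> ccvg (fun t => u t + v t) (l + m).
Proof.
move=> [u1 u2] [v1 v2]; split; rewrite raddfD /=.
  by under eq_cvg do rewrite raddfD /=; exact: cvgD.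
by under eq_cvg do rewrite raddfD /=; exact: cvgD.
Qed.

Lemma ccvgMr u l z : ccvg u l -> ccvg (fun t => u t * z) (l * z).
Proof.
have ReM (x y : R[i]) : complex.Re (x * y) =
    complex.Re x * complex.Re y - complex.Im x * complex.Im y.
  by case: x y => ? ? [].
have ImM (x y : R[i]) : complex.Im (x * y) =
    complex.Re x * complex.Im y + complex.Im x * complex.Re y.
  by case: x y => ? ? [].
move=> [u1 u2]; split; rewrite ?ReM ?ImM.
  by under eq_cvg do rewrite ReM; apply: cvgB; exact: cvgMr_tmp.
by under eq_cvg do rewrite ImM; apply: cvgD; exact: cvgMr_tmp.
Qed.

Lemma ccvg_sum (I : finType) (u : I -> R -> R[i]) (l : I -> R[i]) :
  (forall i, ccvg (u i) (l i)) -> ccvg (fun t => \sum_i u i t) (\sum_i l i).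
Proof.
move=> ul; rewrite /index_enum; elim: (index_enum_key) => /=.
elim: (Finite.enum I) => [|i s IH].
  by rewrite big_nil; under eq_fun do rewrite big_nil; exact: ccvg_cst.
by rewrite big_cons; under eq_fun do rewrite big_cons; exact: ccvgD.
Qed.

(** Each component is the decaying factor [expR (t * x)] times a bounded cosine or sine. *)
Lemma ccvg_cexp z : complex.Re z < 0 -> ccvg (fun t => cexp (t%:C * z)) 0.
Proof.
case: z => x y /= x0.
have ex : expR (t * x) @[t --> +oo] --> (0 : R).
  apply/cvgrPdist_lt => e e0; near=> t.
  rewrite sub0r normrN ger0_norm ?expR_ge0 // -[ltRHS]lnK ?posrE // ltr_expR.
  (* Since [x < 0], the bound holds as soon as [t > ln e / x]. *)
  rewrite -ltr_ndivrMr //.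
  by near: t; apply: nbhs_pinfty_gt; exact: num_real.
have bounded (f : R -> R) : (forall t, `|f t| <= 1) ->
    (expR (t * x) * f t) @[t --> +oo] --> (0 : R).
  move=> f1; apply/cvgr0Pnorm_le => e e0; near=> t.
  rewrite normrM (@le_trans _ _ `|expR (t * x)|) ?ler_piMr //.
  by near: t; move/cvgr0Pnorm_le: ex; exact.
split => /=.
  under eq_cvg do rewrite mul0r subr0 mul0r addr0.
  by apply: bounded => t; exact: cos_max.
under eq_cvg do rewrite mul0r subr0 mul0r addr0.
by apply: bounded => t; exact: sin_max.
Unshelve. all: by end_near. Qed.

End ComplexLimits.

Section LimitProduct.
Variables (R : realType) (d : nat).
Notation C := R[i].
Notation V := 'M[C]_d.
Implicit Types (a b xi : V) (mu : 'I_d -> 'I_d -> C).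

Definition multiplier mu (t : R) a : V :=
  \matrix_(i, j) (cexp (t%:C * mu i j) * a i j).

(* The only products of matrix units which survive in the limit are those
   with a diagonal factor. *)
Definition mul_oo a b : V :=
  \matrix_(i, k) \sum_j ((i == j) || (j == k))%:R * (a i j * b j k).

Definition lie_oo a b : V := (- ('i / 2)) *: (mul_oo a b - mul_oo b a).

Definition jordan_oo_mx a b : V := 2^-1 *: (mul_oo a b + mul_oo b a).

Lemma mul_ooE a b i k : mul_oo a b i k =
  if i == k then a i i * b i i else a i i * b i k + a i k * b k k.
Proof.
rewrite mxE (bigD1 i) //= eqxx mul1r; case: eqVneq => [<-|ik].
  rewrite big1 ?addr0 // => j ji.
  by rewrite eq_sym (negPf ji) mul0r.
rewrite (bigD1 k) 1?eq_sym //= eqxx orbT mul1r big1 ?addr0 // => j /andP[ji jk].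
by rewrite eq_sym (negPf ji) (negPf jk) mul0r.
Qed.

(** The adjoint of a multiplier for the trace pairing is the multiplier with transposed
    exponents. *)
Lemma ev_multiplier mu t a xi : ev (multiplier (fun i j => mu j i) t a) xi =
  ev a (multiplier mu t xi).
Proof.
rewrite /ev /mxtrace; congr complex.Re; apply: eq_bigr => i _; rewrite !mxE.
by apply: eq_bigr => j _; rewrite !mxE; ring.
Qed.

Lemma multiplierNK mu t a : multiplier mu t (multiplier mu (- t) a) = a.
Proof.
apply/matrixP => i j; rewrite !mxE mulrA -cexpD -mulrDl -rmorphD subrr.
by rewrite mul0r cexp0 mul1r.
Qed.

(** Exponents general enough for both models: the frequencies [y] cause oscillations but leave the
    limit unchanged. *)
Definition decoherence_rate (kappa : R) (y : 'I_d -> 'I_d -> R) i j : C :=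
  if i == j then 0 else (- kappa) +i* y i j.

Variables (kappa : R) (y : 'I_d -> 'I_d -> R).
Hypothesis kappa_gt0 : 0 < kappa.
Let nu := decoherence_rate kappa y.
Let nuT i j := nu j i.

(** The point moves by the inverse flow and the matrices of the covectors by the adjoint flow,
    whence the sign of [t] and the transposed exponents. Each term of the triple sum then converges
    according to a single exponent. *)
Lemma tr_mul_oo_cvg a b xi :
  ccvg (fun t => \tr (multiplier nu (- t) xi *m
                      (multiplier nuT t a *m multiplier nuT t b)))
       (\tr (xi *m mul_oo a b)).
Proof.
rewrite /mxtrace; apply: ccvg_sum => k.
under eq_fun do rewrite mxE; rewrite mxE; apply: ccvg_sum => i.
under eq_fun do rewrite [X in _ * X]mxE mulr_sumr.
rewrite [X in _ * X]mxE mulr_sumr.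
apply: ccvg_sum => j.
rewrite (_ : (fun t => _) = fun t => cexp (t%:C * (nu j i + nu k j - nu k i)) *
    (xi k i * (a i j * b j k))); last first.
  apply/funext => t; rewrite !mxE !(mulrBr, mulrDr) !cexpD rmorphN mulNr.
  move: (cexp _) (cexp _) (cexp _) (xi _ _) (a _ _) (b _ _) => *; ring.
rewrite [xi k i * (_%:R * _)]mulrCA; apply: (@ccvgMr _ (fun t => cexp _)).
rewrite /nu /decoherence_rate.
(* If [i = j], then [nu j i = 0] and the other two rates cancel; the case [j = k] is symmetric. *)
have [ij|ij] := eqVneq i j.
  rewrite {}ij add0r subrr /=.
  by under eq_fun do rewrite mulr0 cexp0; exact: ccvg_cst.
rewrite /=.
have [jk|jk] := eqVneq j k.
  rewrite -jk addr0 eq_sym (negPf ij) subrr.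
  by under eq_fun do rewrite mulr0 cexp0; exact: ccvg_cst.
(* The two distinct pairs contribute [- 2 kappa], of which [- nu k i] gives back [kappa] if [k]
   differs from [i] and nothing otherwise. *)
by apply: ccvg_cexp; case: eqP => _ /=; rewrite ?subr0; move: kappa_gt0; lra.
Qed.

End LimitProduct.

(** * Limits of the push-forward tensor fields *)

Section QutritFields.
Variable R : realType.
Notation V := 'M[R[i]]_3.
Implicit Types (a b u v xi : V) (alpha beta : V -> R) (k : R).

Lemma hermP a : a \is hermsymmx <-> forall i j, a i j = conjc (a j i).
Proof.
split=> [ha i j|ha]; first exact: hermE.
apply/is_hermitianmxP; rewrite expr0 scale1r; apply/matrixP => i j.
by rewrite ha !mxE.
Qed.

Lemma conjcD (z w : R[i]) : conjc (z + w) = conjc z + conjc w.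
Proof. exact: rmorphD. Qed.

Lemma conjcM (z w : R[i]) : conjc (z * w) = conjc z * conjc w.
Proof. exact: rmorphM. Qed.

Lemma herm0 : (0 : V) \is hermsymmx.
Proof. by apply/hermP => i j; rewrite !mxE raddf0. Qed.

Lemma hermD a b : a \is hermsymmx -> b \is hermsymmx -> a + b \is hermsymmx.
Proof.
by move=> /hermP ha /hermP hb; apply/hermP => i j; rewrite !mxE conjcD -ha -hb.
Qed.

Lemma hermZ k a : a \is hermsymmx -> k%:C *: a \is hermsymmx.
Proof.
move=> /hermP ha; apply/hermP => i j; by rewrite !mxE conjcM conjc_real -ha.
Qed.

Lemma gellmann_herm j : gellmann R j \is hermsymmx.
Proof.
have mx3_herm s : (forall i j : 'I_3, nth 0 (nth [::] s i) j =
    conjc (nth 0 (nth [::] s j) i) :> R[i]) -> mx3 s \is hermsymmx.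
  by move=> h; apply/hermP => i k; rewrite !mx3E.
move: j => [|[|[|[|[|[|[|[|[|j]]]]]]]]]; [exact: herm0|..|exact: herm0];
  rewrite /gellmann; [..|apply: hermZ]; apply: mx3_herm; elim/ord3P; elim/ord3P;
  by rewrite /= ?conjc0 ?conjc1 ?oppr0 ?opprK //; simpc; rewrite ?oppr0 ?opprK.
Qed.

Lemma gellmann_tr j : \tr (gellmann R j) = 0.
Proof.
case: j => [|[|[|[|[|[|[|[|[|j]]]]]]]]]; rewrite /gellmann ?mxtraceZ;
  rewrite ?mxtrace0 // /mxtrace sum3 !mx3E /=; ring.
Qed.

Lemma evC a b : ev a b = ev b a.
Proof. by rewrite /ev mxtrace_mulC. Qed.

Lemma ev_real_linear a : real_linear (ev a).
Proof.
move=> k u v; rewrite /ev mulmxDl -scalemxAl mxtraceD mxtraceZ raddfD.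
by case: (\tr (u *m a)) => p q; simpc.
Qed.

Lemma real_linear0 alpha : real_linear alpha -> alpha 0 = 0.
Proof.
move=> /(_ 1 0 0); rewrite scaler0 addr0 mul1r => h.
by apply: (@addrI _ (alpha 0)); rewrite -h addr0.
Qed.

Lemma real_linear_sum alpha (r : seq nat) (c : nat -> R) (u : nat -> V) :
  real_linear alpha ->
  alpha (\sum_(j <- r) (c j)%:C *: u j) = \sum_(j <- r) c j * alpha (u j).
Proof.
move=> la; elim: r => [|j r IH]; first by rewrite !big_nil real_linear0.
by rewrite !big_cons la IH.
Qed.

Lemma real_linearZ alpha k u : real_linear alpha ->
  alpha (k%:C *: u) = k * alpha u.
Proof. by move=> la; rewrite -[_ *: u]addr0 la real_linear0 // addr0. Qed.

Lemma real_linearB alpha u v : real_linear alpha ->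
  alpha (u - v) = alpha u - alpha v.
Proof.
move=> la; have -> : u - v = (-1)%:C *: v + u.
  by rewrite rmorphN rmorph1 scaleN1r addrC.
by rewrite la mulN1r addrC.
Qed.

Lemma ev_linl k a b xi : ev (k%:C *: a + b) xi = k * ev a xi + ev b xi.
Proof. by rewrite evC ev_real_linear !(evC xi). Qed.

Lemma invr2C : (2^-1 : R[i]) = (2^-1)%:C.
Proof. by rewrite fmorphV rmorph_nat. Qed.

Lemma sharp_herm alpha : sharp alpha \is hermsymmx.
Proof.
rewrite /sharp invr2C; apply: hermZ.
apply: (big_ind (fun a => a \is hermsymmx)).
- exact: herm0.
- exact: hermD.
- by move=> j _; apply: hermZ; exact: gellmann_herm.
Qed.

Lemma sharp_tr alpha : \tr (sharp alpha) = 0.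
Proof.
rewrite /sharp mxtraceZ raddf_sum big1 ?mulr0 // => j _.
by rewrite /= mxtraceZ gellmann_tr mulr0.
Qed.

Lemma eq_sharp alpha beta :
  (forall j, alpha (gellmann R j) = beta (gellmann R j)) ->
  sharp alpha = sharp beta.
Proof. by move=> e; congr (_ *: _); apply: eq_bigr => j _; rewrite e. Qed.

Lemma sharp_ev_tr0 v : v \is hermsymmx -> \tr v = 0 -> sharp (ev v) = v.
Proof. by move=> hv v0; rewrite sharp_ev // v0 mul0r raddf0 subr0. Qed.

(** As [v] equals [sharp (ev v)], both sides pair the Gell-Mann coefficients of [v] with the values
    of [alpha] on the Gell-Mann matrices. *)
Lemma ev_sharp alpha v : real_linear alpha -> v \is hermsymmx -> \tr v = 0 ->
  ev (sharp alpha) v = alpha v.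
Proof.
move=> la hv v0; rewrite -[in RHS](sharp_ev_tr0 hv v0) evC /sharp invr2C.
rewrite !real_linearZ //; last exact: ev_real_linear.
rewrite !real_linear_sum //; last exact: ev_real_linear.
by congr (_ * _); apply: eq_bigr => j _; rewrite mulrC.
Qed.

Lemma multiplier_tr mu t v : (forall i, mu i i = 0) ->
  \tr (multiplier mu t v) = \tr v.
Proof.
by move=> mu0; apply: eq_bigr => i _; rewrite mxE mu0 mulr0 cexp0 mul1r.
Qed.

Lemma multiplier_herm mu t v : (forall i j, mu j i = conjc (mu i j)) ->
  v \is hermsymmx -> multiplier mu t v \is hermsymmx.
Proof.
move=> muJ /hermP hv; apply/hermP => i j; rewrite !mxE conjcM -hv -cexpJ conjcM.
by rewrite -muJ conjc_real.
Qed.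

Variables (L : V -> V) (kappa : R) (y : 'I_3 -> 'I_3 -> R).
Let nu := decoherence_rate kappa y.
Let nuT i j := nu j i.
Hypothesis kappa_gt0 : 0 < kappa.
Hypothesis y_skew : forall i j, y j i = - y i j.
Hypothesis LE : forall rho i j, L rho i j = nu i j * rho i j.

Lemma decoherence_rateJ i j : nu j i = conjc (nu i j).
Proof.
rewrite /nu /decoherence_rate eq_sym; case: (i == j); first by rewrite raddf0.
by rewrite y_skew.
Qed.

Lemma flow_multiplier t v : flow L t v = multiplier nu t v.
Proof. by apply/matrixP => i j; rewrite (flowE LE) mxE. Qed.

(** The adjoint of the flow represents the pull-back. Testing on the Gell-Mann matrices suffices,
    because multipliers with these rates preserve traceless Hermitian matrices. *)
Lemma sharp_flow t alpha : real_linear alpha ->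
  sharp (alpha \o flow L t) = multiplier nuT t (sharp alpha).
Proof.
move=> la.
have nu0 i : nu i i = 0 by rewrite /nu /decoherence_rate eqxx.
rewrite (@eq_sharp _ (ev (multiplier nuT t (sharp alpha)))).
  rewrite sharp_ev_tr0 //.
    apply: multiplier_herm; last exact: sharp_herm.
    by move=> i j; exact: decoherence_rateJ.
  by rewrite multiplier_tr ?sharp_tr.
move=> j; rewrite /= ev_multiplier flow_multiplier ev_sharp //.
  apply: multiplier_herm; last exact: gellmann_herm.
  exact: decoherence_rateJ.
by rewrite multiplier_tr // gellmann_tr.
Qed.

Lemma pushforward_LambdaD_cvg xi alpha beta :
  real_linear alpha -> real_linear beta ->
  Defs.pushforward L t (@LambdaD R) xi alpha beta @[t --> +oo] -->
    ev (lie_oo (sharp alpha) (sharp beta)) xi.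
Proof.
move=> la lb; rewrite /Defs.pushforward /LambdaD.
under eq_cvg do rewrite !sharp_flow // flow_multiplier.
have h a b := tr_mul_oo_cvg y kappa_gt0 a b xi.
have lieE (a b x : V) : \tr (x *m ((- ('i / 2)) *: (a - b))) =
    \tr (x *m a) * (- ('i / 2)) + \tr (x *m b) * ('i / 2).
  by rewrite -scalemxAr mxtraceZ mulmxBr linearB /=; ring.
(* The commutator is a complex combination of two convergent traces; [proj1] retains the real
   part. *)
have /proj1 h' := ccvgD (ccvgMr (- ('i / 2)) (h (sharp alpha) (sharp beta)))
  (ccvgMr ('i / 2) (h (sharp beta) (sharp alpha))).
have -> : ev (lie_oo (sharp alpha) (sharp beta)) xi =
  complex.Re (\tr (xi *m lie_oo (sharp alpha) (sharp beta))) by [].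
rewrite /lie_oo lieE; apply: cvg_trans h'; apply: near_eq_cvg.
by apply: nearW => t; rewrite /ev /lie lieE.
Qed.

Lemma pushforward_RD_cvg xi alpha beta :
  real_linear alpha -> real_linear beta ->
  Defs.pushforward L t (@RD R) xi alpha beta @[t --> +oo] -->
    ev (jordan_oo_mx (sharp alpha) (sharp beta)) xi
    - ev (sharp alpha) xi * ev (sharp beta) xi.
Proof.
move=> la lb; rewrite /Defs.pushforward /RD.
(* The inverse flow on the point cancels the flow on the covectors, so the product of expectation
   values does not depend on [t]. *)
under eq_cvg do rewrite !sharp_flow // flow_multiplier !ev_multiplier
  !multiplierNK.
apply: cvgB; last exact: cvg_cst.
have h a b := tr_mul_oo_cvg y kappa_gt0 a b xi.
have jordanE (a b x : V) : \tr (x *m (2^-1 *: (a + b))) =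
    \tr (x *m a) * 2^-1 + \tr (x *m b) * 2^-1 :> R[i].
  by rewrite -scalemxAr mxtraceZ mulmxDr linearD /=; ring.
have /proj1 h' := ccvgD (ccvgMr 2^-1 (h (sharp alpha) (sharp beta)))
  (ccvgMr 2^-1 (h (sharp beta) (sharp alpha))).
have -> : ev (jordan_oo_mx (sharp alpha) (sharp beta)) xi =
  complex.Re (\tr (xi *m jordan_oo_mx (sharp alpha) (sharp beta))) by [].
rewrite /jordan_oo_mx jordanE; apply: cvg_trans h'; apply: near_eq_cvg.
by apply: nearW => t; rewrite /ev /jordan jordanE.
Qed.

End QutritFields.

(** * Differentials of expectation value functions *)

Section Differentials.
Variable R : realType.
Notation V := 'M[R[i]]_3.
Implicit Types (a b u v : V) (alpha beta : V -> R) (rho tau : density R).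

(** Rank-one matrices, pure states when normalized. Indexing [w] by naturals lets it be read off a
    literal sequence. *)
Definition pure_mx (c : R) (w : nat -> R[i]) : V :=
  \matrix_(i, j) (c%:C * (w i * conjc (w j))).

Lemma pure_mx_density (c : R) (w : nat -> R[i]) : 0 <= c ->
  c%:C * (\sum_(i < 3) w i * conjc (w i)) = 1 ->
  is_density (pure_mx c w).
Proof.
move=> c0 cw; split.
- apply/hermP => i j; rewrite !mxE !conjcM conjc_real conjcK.
  by congr (_ * _); rewrite mulrC.
(* The quadratic form at [v] is [c] times the squared modulus of the inner product [z] of [v] and
   [w]. *)
- move=> v; pose z := \sum_i conjc (v i 0) * w i.
  suff -> : ((map_mx Num.conj v^T *m pure_mx c w *m v) 0 0) =
      c%:C * (z * conjc z).
    by rewrite mulr_ge0 ?ler0c // mulcJ_ge0.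
  rewrite mxE (eq_bigr (fun j => c%:C * z * conjc (conjc (v j 0) * w j))).
    by rewrite -mulr_sumr -rmorph_sum mulrA.
  move=> j _; rewrite mxE /z mulr_sumr !mulr_suml; apply: eq_bigr => i _.
  rewrite !mxE conjcM conjcK -[Num.conj _]/(conjc _).
  by rewrite -mulrA; ring.
by rewrite -cw mulr_sumr; apply: eq_bigr => i _; rewrite mxE.
Qed.

Lemma convex_density (s : R) rho tau : 0 <= s -> s <= 1 ->
  is_density (s%:C *: density_mx tau + (1 - s)%:C *: density_mx rho).
Proof.
move=> s0 s1; have [ht pt tt] := densityP tau; have [hr pr tr] := densityP rho.
split.
- by apply: hermD; apply: hermZ.
- move=> v; rewrite mulmxDr mulmxDl -!scalemxAr -!scalemxAl.
  rewrite mxE [X in X + _]mxE [X in _ + X]mxE.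
  by rewrite addr_ge0 // mulr_ge0 // ler0c // subr_ge0.
by rewrite mxtraceD !mxtraceZ tt tr !mulr1 -rmorphD subrKC.
Qed.

Lemma hsnormZ (s : R) v : hsnorm (s%:C *: v) = `|s| * hsnorm v.
Proof.
rewrite /hsnorm real_linearZ; last exact: ev_real_linear.
rewrite evC real_linearZ; last exact: ev_real_linear.
by rewrite mulrA -expr2 sqrtrM ?sqr_ge0 // sqrtr_sqr.
Qed.

(* Only directions towards other density matrices are tested, so that this
   also holds at boundary points. *)
Lemma differential_unique (f : density R -> R) rho alpha beta tau :
  is_differential f rho alpha -> is_differential f rho beta ->
  alpha (density_mx tau - density_mx rho) =
  beta (density_mx tau - density_mx rho).
Proof.
move=> [la da] [lb db]; set D := _ - _; set N := hsnorm D.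
have N0 : 0 <= N by exact: sqrtr_ge0.
apply/eqP; rewrite -subr_eq0 -normr_eq0; apply: contraT => c0.
set c := `|_| in c0; have {}c0 : 0 < c by rewrite lt_def c0 normr_ge0.
(* The two estimates will give [c <= 2 * e * N], which this choice makes absurd; [N + 1] avoids a
   division by zero when [N = 0]. *)
pose e := c / (4 * (N + 1)).
have e0 : 0 < e by rewrite divr_gt0 // mulr_gt0 // ltr_wpDl.
have [d1 d10 h1] := da e e0; have [d2 d20 h2] := db e e0.
pose d := Num.min d1 d2; have d0 : 0 < d by rewrite lt_min d10.
have dN0 : 0 < d + N by rewrite ltr_pwDl.
(* This weight satisfies both [s <= 1] and [s * N < d], so [sigma] is a state on the segment from
   [rho] to [tau] and close enough to [rho]. *)
pose s := d / (d + N); have s0 : 0 < s by rewrite divr_gt0.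
have s1 : s <= 1 by rewrite ler_pdivrMr // mul1r lerDl.
pose sigma := Density (convex_density rho tau (ltW s0) s1).
have sD : density_mx sigma - density_mx rho = s%:C *: D.
  rewrite /= /D rmorphB rmorph1 scalerBl scale1r scalerBr.
  by rewrite [_ - s%:C *: _]addrC addrA addrK.
have sN : hsnorm (density_mx sigma - density_mx rho) = s * N.
  by rewrite sD hsnormZ gtr0_norm.
have sNd : s * N < d.
  by rewrite /s mulrAC ltr_pdivrMr // ltr_pM2l // ltrDr.
move: (h1 sigma) (h2 sigma); rewrite sN sD !real_linearZ //.
move: sNd; rewrite lt_min => /andP[sd1 sd2] /(_ sd1) k1 /(_ sd2) k2.
have : s * c <= 2 * (e * (s * N)).
  rewrite /c -[s in s * `|_|]gtr0_norm // -normrM.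
  set F := f sigma - f rho in k1 k2.
  have -> : s * (alpha D - beta D) =
      (F - s * beta D) - (F - s * alpha D) by ring.
  by apply: le_trans (ler_normB _ _) _; rewrite mulr_natl mulr2n lerD.
rewrite [leRHS](_ : _ = s * (2 * (e * N))); last by ring.
rewrite ler_pM2l // /e.
have -> : 2 * (c / (4 * (N + 1)) * N) = c * (N / (2 * (N + 1))).
  by field; rewrite gt_eqF // ltr_wpDl.
rewrite -[leLHS]mulr1 ler_pM2l // ler_pdivlMr ?mulr_gt0 ?ltr_wpDl //.
by move=> ?; lra.
Qed.

(** * Differences of density matrices determine a covector *)

Section Agreement.
Variables alpha beta : V -> R.
Hypotheses (la : real_linear alpha) (lb : real_linear beta).
Hypothesis ab : forall rho tau, alpha (density_mx tau - density_mx rho) =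
                                beta (density_mx tau - density_mx rho).

Lemma agree_pure c (w w' : nat -> R[i]) (g : V) : 0 <= c ->
  c%:C * (\sum_(i < 3) w i * conjc (w i)) = 1 ->
  c%:C * (\sum_(i < 3) w' i * conjc (w' i)) = 1 ->
  g = pure_mx c w - pure_mx c w' -> alpha g = beta g.
Proof.
move=> c0 h h' ->.
exact: (ab (Density (pure_mx_density c0 h')) (Density (pure_mx_density c0 h))).
Qed.

(* Polarization: with P w the rank one matrix of w, the matrix g is half of
   P (u + v) - P (u - v). *)
Lemma agree_offdiag (u v : seq R[i]) (g : V) :
  \sum_(i < 3) u`_i * conjc u`_i = 1 -> \sum_(i < 3) v`_i * conjc v`_i = 1 ->
  (forall i : 'I_3, u`_i * conjc v`_i = 0) ->
  (forall i j : 'I_3, g i j = u`_i * conjc v`_j + v`_i * conjc u`_j) ->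
  alpha g = beta g.
Proof.
move=> hu hv huv gE.
have half_ge0 : 0 <= 2^-1 :> R by rewrite invr_ge0.
(* Both signs at once: as [u] and [v] have disjoint supports, [u + e v] has squared norm 2, whence
   the factor one half. *)
have N e : e * e = 1 :> R -> (2^-1)%:C *
    (\sum_(i < 3) (u`_i + e%:C * v`_i) * conjc (u`_i + e%:C * v`_i)) = 1.
  move=> e1; transitivity ((2^-1)%:C * (\sum_(i < 3) u`_i * conjc u`_i +
      \sum_(i < 3) v`_i * conjc v`_i) : R[i]).
    congr (_ * _); rewrite -big_split; apply: eq_bigr => i _ /=.
    rewrite conjcD conjcM conjc_real mulrDl !mulrDr.
    rewrite [u`_i * (_ * _)]mulrCA huv mulr0 addr0.
    have -> : e%:C * v`_i * conjc u`_i = e%:C * conjc (u`_i * conjc v`_i).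
      by rewrite conjcM conjcK -mulrA; congr (_ * _); rewrite mulrC.
    rewrite huv conjc0 mulr0 add0r; congr (_ + _).
    by rewrite mulrACA -rmorphM e1 rmorph1 mul1r.
  by rewrite hu hv -invr2C mulVf.
have N1 := N 1 (mulr1 1); have Nm1 := N (-1) (etrans (mulrNN 1 1) (mulr1 1)).
apply: (agree_pure (w := fun i => u`_i + 1%:C * v`_i)
  (w' := fun i => u`_i + (-1)%:C * v`_i) half_ge0 N1 Nm1).
apply/matrixP => i j; rewrite gE !mxE !conjcD !conjcM !conjc_real -invr2C.
rewrite !rmorphN !rmorph1.
by move: u`_i v`_i (conjc u`_j) (conjc v`_j) => a b c d; field.
Qed.

Lemma agree_diag (p q : nat) (g : V) : (p < 3)%N -> (q < 3)%N ->
  (forall i j : 'I_3, g i j = ((i == p :> nat) && (j == p :> nat))%:R -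
    ((i == q :> nat) && (j == q :> nat))%:R) -> alpha g = beta g.
Proof.
move=> p3 q3 gE; pose w (r : nat) (i : nat) : R[i] := (i == r)%:R.
have N r : (r < 3)%N -> 1%:C * (\sum_(i < 3) w r i * conjc (w r i)) = 1.
  move=> r3; rewrite mul1r (bigD1 (Ordinal r3)) //= /w eqxx conjc1 mulr1.
  rewrite big1 ?addr0 // => i ir; rewrite -val_eqE /= in ir.
  by rewrite (negPf ir) mul0r.
apply: (agree_pure (w := w p) (w' := w q) ler01 (N p p3) (N q q3)).
apply/matrixP => i j; rewrite gE !mxE !mul1r /w.
move: (_ == p :> nat) (_ == p :> nat) (_ == q :> nat) (_ == q :> nat).
by do 4!case; rewrite ?conjc0 ?conjc1 ?mulr0 ?mulr1 ?mul0r.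
Qed.

(** Up to scale each Gell-Mann matrix is a difference of two pure states or, for [j = 8], a sum of
    two such differences. *)
Lemma agree_gellmann j : alpha (gellmann R j) = beta (gellmann R j).
Proof.
have conjci : conjc 'i = - 'i :> R[i].
  by apply/eqP; rewrite eq_complex /= oppr0 !eqxx.
have ii : 'i * - 'i = 1 :> R[i] by rewrite mulrN -expr2 sqr_i opprK.
pose simp := (conjc0, conjc1, conjci, mul0r, mulr0, mul1r, mulr1, addr0, add0r,
  subr0, sub0r, subrr, oppr0, ii).
move: j => [|[|[|[|[|[|[|[|[|j]]]]]]]]]; rewrite /gellmann.
- by rewrite !real_linear0.
- refine (agree_offdiag (u := [:: 1; 0; 0]) (v := [:: 0; 1; 0]) _ _ _ _)
    => [|||i k];
    rewrite ?sum3 ?mx3E; [| |elim/ord3P|elim/ord3P: i; elim/ord3P: k];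
    by rewrite /= ?simp //; apply/eqP; rewrite eq_complex /= ?simp ?mulrN ?simp
      ?opprK ?eqxx.
(* The phase [i] in [v] turns the symmetric Gell-Mann matrix into the antisymmetric one. *)
- refine (agree_offdiag (u := [:: 1; 0; 0]) (v := [:: 0; 'i; 0]) _ _ _ _)
    => [|||i k];
    rewrite ?sum3 ?mx3E; [| |elim/ord3P|elim/ord3P: i; elim/ord3P: k];
    by rewrite /= ?simp //; apply/eqP; rewrite eq_complex /= ?simp ?mulrN ?simp
      ?opprK ?eqxx.
- apply: (@agree_diag 0 1) => // i k; rewrite mx3E.
  by elim/ord3P: i; elim/ord3P: k; rewrite /= ?simp.
- refine (agree_offdiag (u := [:: 1; 0; 0]) (v := [:: 0; 0; 1]) _ _ _ _)
    => [|||i k];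
    rewrite ?sum3 ?mx3E; [| |elim/ord3P|elim/ord3P: i; elim/ord3P: k];
    by rewrite /= ?simp //; apply/eqP; rewrite eq_complex /= ?simp ?mulrN ?simp
      ?opprK ?eqxx.
- refine (agree_offdiag (u := [:: 1; 0; 0]) (v := [:: 0; 0; 'i]) _ _ _ _)
    => [|||i k];
    rewrite ?sum3 ?mx3E; [| |elim/ord3P|elim/ord3P: i; elim/ord3P: k];
    by rewrite /= ?simp //; apply/eqP; rewrite eq_complex /= ?simp ?mulrN ?simp
      ?opprK ?eqxx.
- refine (agree_offdiag (u := [:: 0; 1; 0]) (v := [:: 0; 0; 1]) _ _ _ _)
    => [|||i k];
    rewrite ?sum3 ?mx3E; [| |elim/ord3P|elim/ord3P: i; elim/ord3P: k];
    by rewrite /= ?simp //; apply/eqP; rewrite eq_complex /= ?simp ?mulrN ?simp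
      ?opprK ?eqxx.
- refine (agree_offdiag (u := [:: 0; 1; 0]) (v := [:: 0; 0; 'i]) _ _ _ _)
    => [|||i k];
    rewrite ?sum3 ?mx3E; [| |elim/ord3P|elim/ord3P: i; elim/ord3P: k];
    by rewrite /= ?simp //; apply/eqP; rewrite eq_complex /= ?simp ?mulrN ?simp
      ?opprK ?eqxx.
- rewrite !real_linearZ //; congr (_ * _).
  (* The matrix [diag(1, 1, -2)] is [diag(1, 0, -1)] plus [diag(0, 1, -1)]. *)
  pose g (p : nat) : V := mx3 [:: [:: (p == 0%N)%:R; 0; 0]; 
    [:: 0; (p == 1%N)%:R; 0];    [:: 0; 0; -1]].
  have gE p : (p < 2)%N -> alpha (g p) = beta (g p).
    case: p => [|[|//]] _; [apply: (@agree_diag 0 2)|apply: (@agree_diag 1 2)];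
      by move=> // i k; rewrite mx3E; elim/ord3P: i; elim/ord3P: k;
      rewrite /= ?simp.
  rewrite [mx3 _](_ : _ = (1%:C : R[i]) *: g 0%N + g 1%N).
    by rewrite la lb !gE.
  apply/matrixP => i k; rewrite !mxE.
  by elim/ord3P: i; elim/ord3P: k; rewrite /= ?simp // -opprD.
- by rewrite !real_linear0.
Qed.

End Agreement.

Lemma expect_is_differential a rho : is_differential (expect a) rho (ev a).
Proof.
split=> [|e e0]; first exact: ev_real_linear.
(* The function is affine, so the remainder is zero and any radius works. *)
exists 1 => // sigma _; rewrite /expect real_linearB;
  last exact: ev_real_linear.
by rewrite subrr normr0 mulr_ge0 ?(ltW e0) // /hsnorm sqrtr_ge0.
Qed.

(** The differential is merely chosen by [xget]. Uniqueness fixes it on differences of states, hence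
    on the Gell-Mann matrices, which are all that [sharp] sees. *)
Lemma differential_expect a rho :
  real_linear (differential (expect a) rho) /\
  sharp (differential (expect a) rho) = sharp (ev a).
Proof.
have h : is_differential (expect a) rho (differential (expect a) rho).
  by apply: xgetI; exact: expect_is_differential.
split; first exact: h.1.
apply: eq_sharp; apply: agree_gellmann; [exact: h.1|exact: ev_real_linear|].
move=> sigma tau.
have := differential_unique tau h (expect_is_differential a rho).
have := differential_unique sigma h (expect_is_differential a rho).
move: h => [la _] {}h h'.
(* Uniqueness concerns directions issuing from [rho], so a general difference is routed through
   [rho]. *)
have -> : density_mx tau - density_mx sigma =
    (density_mx tau - density_mx rho) - (density_mx sigma - density_mx rho).
  by rewrite opprB addrA subrK.
by rewrite (real_linearB _ _ la) (real_linearB _ _ (ev_real_linear a)) h h'.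
Qed.

End Differentials.

(** * Algebraic identities of the limit products *)

Section LimitAlgebra.
Variables (R : realType) (d : nat).
Implicit Types (a b c : 'M[R[i]]_d).

(** The right side vanishes for [i = k], where the limit commutator does too, so no case distinction
    is needed. *)
Lemma lie_ooE a b i k : lie_oo a b i k =
  - ('i / 2) * ((a i i - a k k) * b i k - (b i i - b k k) * a i k).
Proof.
rewrite /lie_oo mxE; congr (_ * _).
rewrite mxE [X in _ + X]mxE !mul_ooE; case: eqVneq => [<-|_]; ring.
Qed.

Lemma jordan_oo_mxE a b i k : jordan_oo_mx a b i k =
  if i == k then a i i * b i i
  else 2^-1 * ((a i i + a k k) * b i k + (b i i + b k k) * a i k).
Proof.
by rewrite /jordan_oo_mx mxE mxE !mul_ooE; case: eqVneq => _; field.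
Qed.

End LimitAlgebra.

(* The entrywise formulas are taken as hypotheses so that rewriting does not
   unfold the products. *)
Section EntrywiseProducts.
Variables (R : realType) (d : nat).
Notation V := 'M[R[i]]_d.
Variables br jo : V -> V -> V.
Hypothesis brE : forall a b i k, br a b i k =
  - ('i / 2) * ((a i i - a k k) * b i k - (b i i - b k k) * a i k).
Hypothesis joE : forall a b i k, jo a b i k =
  if i == k then a i i * b i i
  else 2^-1 * ((a i i + a k k) * b i k + (b i i + b k k) * a i k).
Implicit Types (a b c : V).

Lemma br_linl (z : R[i]) a b c :
  br (z *: a + b) c = z *: br a c + br b c.
Proof.
apply/matrixP => i k; rewrite !(mxE, brE); ring.
Qed.

Lemma br_skew a b : br b a = - br a b.
Proof. by apply/matrixP => i k; rewrite !(mxE, brE); ring. Qed.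

Lemma br_jacobi a b c :
  br a (br b c) + br b (br c a) + br c (br a b) = 0.
Proof.
apply/matrixP => i k; rewrite !(mxE, brE); ring.
Qed.

Lemma jo_linl (z : R[i]) a b c :
  jo (z *: a + b) c = z *: jo a c + jo b c.
Proof.
apply/matrixP => i k; rewrite !(mxE, joE).
by case: eqP => _; ring.
Qed.

Lemma joC a b : jo b a = jo a b.
Proof.
by apply/matrixP => i k; rewrite !joE; case: eqP => _; ring.
Qed.

Lemma jo_jordan a b :
  jo (jo a b) (jo a a) =
  jo a (jo b (jo a a)).
Proof.
apply/matrixP => i k; rewrite !joE !eqxx; case: eqP => _; first by ring.
by field.
Qed.

Lemma br_derivation a b c :
  br a (jo b c) =
  jo (br a b) c + jo b (br a c).
Proof.
apply/matrixP => i k; rewrite !(mxE, joE, brE) !eqxx.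
by case: eqVneq => [<-|_]; [ring|field].
Qed.

Lemma br_jo_associator a b c :
  jo a (jo b c) - jo (jo a b) c =
  br a (br b c) - br (br a b) c.
Proof.
apply/matrixP => i k; rewrite !(mxE, joE, brE) !eqxx.
have : - ('i / 2) * - ('i / 2) = - 4^-1 :> R[i].
  by rewrite mulrNN mulrACA -expr2 sqr_i mulN1r -invfM -natrM.
move: (- ('i / 2)) => s s2; case: eqVneq => [<-|_]; first by ring.
have E p q : s * (s * p) - s * (s * q) = - 4^-1 * (p - q) by rewrite -s2; ring.
(* Brackets have zero diagonal, so the right side is this polynomial with [s * s] in front; [- 4^-1]
   comes from the halves of the Jordan product, and the two constants agree for [mu = 1]. *)
transitivity (- 4^-1 * ((a i i - a k k) * ((b i i - b k k) * c i k
    - (c i i - c k k) * b i k)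
    + (c i i - c k k) * ((a i i - a k k) * b i k - (b i i - b k k) * a i k))).
  by field.
by rewrite -s2; ring.
Qed.

(** Needed because [sharp (ev a)] is only the traceless part of [a]. *)
Lemma br_shift a b (s t : R[i]) : br (a - s%:M) (b - t%:M) = br a b.
Proof.
apply/matrixP => i k; rewrite !(mxE, brE) !eqxx.
by case: eqVneq => [<-|_]; rewrite ?mulr1n ?mulr0n; ring.
Qed.

(** The correction terms cancel those of the product of expectation values in [RD]. *)
Lemma jo_shift a b (s t : R) :
  jo (a - s%:C%:M) (b - t%:C%:M) =
  jo a b - s%:C *: b - t%:C *: a - (- (s * t))%:C%:M.
Proof.
have -> : (- (s * t))%:C = - (s%:C * t%:C) by rewrite rmorphN rmorphM.
move: s%:C t%:C => z w.
apply/matrixP => i k; rewrite !(mxE, joE) !eqxx.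
by case: eqVneq => [<-|_]; rewrite ?mulr1n ?mulr0n; field.
Qed.

End EntrywiseProducts.

Section HermitianProducts.
Variable R : realType.
Notation V := 'M[R[i]]_3.
Variables br jo : V -> V -> V.
Hypothesis brE : forall a b i k, br a b i k =
  - ('i / 2) * ((a i i - a k k) * b i k - (b i i - b k k) * a i k).
Hypothesis joE : forall a b i k, jo a b i k =
  if i == k then a i i * b i i
  else 2^-1 * ((a i i + a k k) * b i k + (b i i + b k k) * a i k).
Implicit Types (a b : V).

(** Conjugation flips the sign of [i / 2], and exchanging the indices flips the differences of
    diagonal entries. *)
Lemma br_herm a b : a \is hermsymmx -> b \is hermsymmx ->
  br a b \is hermsymmx.
Proof.
move=> /hermP ha /hermP hb; apply/hermP => i j; rewrite !brE.
have conj_i2 : conjc (- ('i / 2)) = 'i / 2 :> R[i].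
  by rewrite invr2C; apply/eqP; rewrite eq_complex /= !(mulr0, mul0r, subr0,
    addr0, add0r, oppr0, opprK, mul1r) !eqxx.
have cB (z w : R[i]) : conjc (z - w) = conjc z - conjc w by exact: rmorphB.
rewrite conjcM conj_i2 !(cB, conjcM) -!ha -!hb; ring.
Qed.

Lemma jo_herm a b : a \is hermsymmx -> b \is hermsymmx ->
  jo a b \is hermsymmx.
Proof.
move=> /hermP ha /hermP hb; apply/hermP => i j; rewrite !joE invr2C.
rewrite [j == i]eq_sym; case: eqVneq => [<-|_]; first by rewrite conjcM -ha -hb.
rewrite !(conjcM, conjcD) conjc_real -!ha -!hb; ring.
Qed.

End HermitianProducts.


(** * From limit tensor fields to matrix products *)

Section LimitProductsOfExpectations.
Variable R : realType.
Notation V := 'M[R[i]]_3.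
Implicit Types (a b : V).

Variables (L : V -> V) (kappa : R) (y : 'I_3 -> 'I_3 -> R).
Hypothesis kappa_gt0 : 0 < kappa.
Hypothesis y_skew : forall i j, y j i = - y i j.
Hypothesis LE : forall rho i j,
  L rho i j = decoherence_rate kappa y i j * rho i j.

(** The right side does not mention [L]: the axioms, the tables and the agreement of the models
    become questions about matrices. *)
Lemma poisson_oo_expect a b : a \is hermsymmx -> b \is hermsymmx ->
  poisson_oo L (expect a) (expect b) = expect (lie_oo a b).
Proof.
move=> ha hb; apply/funext => rho; rewrite /poisson_oo /limit_field.
have [la sa] := differential_expect a rho.
have [lb sb] := differential_expect b rho.
have := pushforward_LambdaD_cvg kappa_gt0 y_skew LE la lb
  (xi := density_mx rho).
rewrite sa sb !sharp_ev // (br_shift (@lie_ooE _ _)) => h.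
exact: cvg_lim h.
Qed.

Lemma jordan_oo_expect a b : a \is hermsymmx -> b \is hermsymmx ->
  jordan_oo L (expect a) (expect b) = expect (jordan_oo_mx a b).
Proof.
move=> ha hb; apply/funext => rho; rewrite /jordan_oo /limit_field.
have [la sa] := differential_expect a rho.
have [lb sb] := differential_expect b rho.
have := pushforward_RD_cvg kappa_gt0 y_skew LE la lb (xi := density_mx rho).
rewrite sa sb !sharp_ev // => /cvg_lim -> //.
have i3 : (3^-1 : R[i]) = (3^-1)%:C by rewrite fmorphV rmorph_nat.
rewrite (herm_tr ha) (herm_tr hb) i3 -!rmorphM /=.
rewrite (jo_shift (@jordan_oo_mxE _ _)).
have [_ _ tr1] := densityP rho.
have evZ k c : ev (k%:C *: c) (density_mx rho) = k * ev c (density_mx rho).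
  by rewrite evC real_linearZ ?(evC c) //; exact: ev_real_linear.
rewrite !evB !evZ !ev_scalar // /expect; ring.
Qed.

End LimitProductsOfExpectations.

(** * Structure constants in the Gell-Mann basis *)

Section Tables.
Variable R : realType.
Notation V := 'M[R[i]]_3.
Implicit Types (a b : V).

Lemma expectD a b : expect (a + b) = expect a + expect b.
Proof.
apply/funext => rho; rewrite /expect !fctE -[in LHS](scale1r a).
by rewrite -(rmorph1 (real_complex R)) ev_linl mul1r.
Qed.

Lemma expectZ (k : R) a : expect (k%:C *: a) = k *: expect a.
Proof.
apply/funext => rho; rewrite /expect evC.
by rewrite (real_linearZ _ _ (ev_real_linear _)) evC.
Qed.

Lemma expectN a : expect (- a) = - expect a.
Proof. by have := expectZ (-1) a; rewrite rmorphN rmorph1 !scaleN1r. Qed.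

Lemma expect0 : expect (0 : V) = 0.
Proof. by have := expectZ 0 0; rewrite scaler0 scale0r. Qed.

Lemma expect_scalar (k : R) : expect (k%:C%:M : V) = cst k.
Proof.
by apply/funext => rho; rewrite /expect ev_scalar //; case: (densityP rho).
Qed.

Let s : R[i] := (Num.sqrt 3)^-1%:C.

Lemma sqr_invsqrt3 : s * s = 3^-1.
Proof.
by rewrite /s -rmorphM -invfM -expr2 sqr_sqrtr // fmorphV rmorph_nat.
Qed.

(** Makes all coefficients polynomial in [s], whose square is one third. *)
Lemma sqrt3C : (Num.sqrt 3)%:C = 3 * s :> R[i].
Proof.
have s0 : s != 0 by rewrite fmorph_eq0 invr_eq0 sqrtr_eq0 -ltNge.
apply: (mulfI s0); rewrite mulrCA sqr_invsqrt3 divff ?pnatr_eq0 // -rmorphM.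
by rewrite mulVf // sqrtr_eq0 -ltNge.
Qed.

Lemma mul_ii : 'i%R * 'i%R = -1 :> R[i].
Proof. by rewrite -expr2 sqrCi. Qed.

Lemma expect_lie_listed j k f : poisson_listed R j k = Some f ->
  expect (lie_oo (gellmann R j) (gellmann R k)) = f.
Proof.
have ss := sqr_invsqrt3; have ii := mul_ii.
have s3 : (Num.sqrt 3 / 2)%:C = 3 * s / 2.
  by rewrite -sqrt3C invr2C; exact: rmorphM.
have s3N : (- (Num.sqrt 3 / 2))%:C = - (3 * s / 2).
  by rewrite -s3; exact: rmorphN.
have i2N : (- 2^-1)%:C = - 2^-1 :> R[i].
  by rewrite invr2C; exact: rmorphN.
move: j k => [|[|[|[|[|[|[|[|j]]]]]]]] [|[|[|[|[|[|[|[|[|k]]]]]]]]] //= [<-];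
  rewrite /xcoord -?expectN -?expectZ; congr expect; apply/matrixP => i k;
  rewrite lie_ooE !mxE -?/s ?(s3, s3N, i2N) -?invr2C ?complexiE;
  elim/ord3P: i; elim/ord3P: k => /=; rewrite ?complexiE;
  (* With the imaginary unit and [s] as atoms, each entry is a field identity modulo [ii]. *)
  move: ('i%R : R[i]) s ss ii => z w ss ii; by field: ii.
Qed.

Lemma expect_jordan_listed j k f : jordan_listed R j k = Some f ->
  expect (jordan_oo_mx (gellmann R j) (gellmann R k)) = f.
Proof.
have ss := sqr_invsqrt3; have ii := mul_ii.
have s2N : (- (2 * Num.sqrt 3)^-1)%:C = - (s / 2).
  by rewrite invr2C /s -rmorphM -rmorphN invfM mulrC.
have i2N : (- 2^-1)%:C = - 2^-1 :> R[i].
  by rewrite invr2C; exact: rmorphN.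
(* Written so that the square of [gellmann R 8] becomes a polynomial identity in [s]. *)
have c23 : (2 / 3)%:C = 2 * (s * s) :> R[i].
  by rewrite rmorphM fmorphV !rmorph_nat ss.
move: j k => [|[|[|[|[|[|[|[|[|j]]]]]]]]] [|[|[|[|[|[|[|[|[|k]]]]]]]]] //= [<-];
  rewrite /xcoord -?expect_scalar -?expectZ -?expectN -?expectD;
  congr expect; apply/matrixP => i k;
  rewrite jordan_oo_mxE !mxE -?/s ?(s2N, i2N, c23) -?invr2C ?complexiE;
  elim/ord3P: i; elim/ord3P: k => /=; rewrite ?complexiE ?mulr1n ?mulr0n;
  move: ('i%R : R[i]) s ss ii => z w ss ii;
  first [by field: ii
    (* For the entries equal to 1 in the square of [gellmann R 3], which require
       [3 * (w * w) = 1]. *)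
    | by transitivity (3 * (w * w)); [rewrite ss; field|ring]].
Qed.

Lemma gellmann_offdiag j i : j != 3%N -> j != 8%N -> gellmann R j i i = 0.
Proof.
move: j => [|[|[|[|[|[|[|[|[|j]]]]]]]]] //= _ _;
  rewrite ?mx3E; try by rewrite mxE.
all: by elim/ord3P: i.
Qed.

Lemma gellmann_diag j i k : (j == 3%N) || (j == 8%N) -> i != k ->
  gellmann R j i k = 0.
Proof.
case/orP=> /eqP ->; rewrite /gellmann ?mxE ?mx3E;
  by elim/ord3P: i; elim/ord3P: k => //= _; rewrite ?mulr0.
Qed.

(** Off-diagonal matrices have zero limit product, diagonal ones commute, and [gellmann R 8] is
    scalar on the first two levels, where [gellmann R 1] and [gellmann R 2] live. *)
Lemma lie_unlisted j k : poisson_listed R j k = None ->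
  poisson_listed R k j = None -> (1 <= j <= 8)%N -> (1 <= k <= 8)%N ->
  lie_oo (gellmann R j) (gellmann R k) = 0.
Proof.
have offdiag a b : (forall i, a i i = 0) -> (forall i, b i i = 0) ->
    lie_oo a b = 0.
  move=> a0 b0; apply/matrixP => i l.
  by rewrite lie_ooE mxE !a0 !b0 !subr0 !mul0r subrr mulr0.
have diag a b : (forall i l, i != l -> a i l = 0) ->
    (forall i l, i != l -> b i l = 0) -> lie_oo a b = 0.
  move=> a0 b0; apply/matrixP => i l; rewrite lie_ooE mxE.
  have [<-|il] := eqVneq i l; first by rewrite !subrr !mul0r subrr mulr0.
  by rewrite (a0 i l) // (b0 i l) // !mulr0 subrr mulr0.
have mixed j' : (j' == 1%N) || (j' == 2%N) ->
    lie_oo (gellmann R j') (gellmann R 8) = 0.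
  by case/orP=> /eqP ->; apply/matrixP => i l; rewrite lie_ooE !mxE;
    elim/ord3P: i; elim/ord3P: l; rewrite /= ?(mulr0, subrr, mul0r, subr0).
move: j k => [|[|[|[|[|[|[|[|[|j]]]]]]]]] [|[|[|[|[|[|[|[|[|k]]]]]]]]] //;
  move=> _ _ _ _;
  first [ by apply: offdiag => i; apply: gellmann_offdiag
        | by apply: diag => i l; apply: gellmann_diag
        | exact: mixed
        | by rewrite (br_skew (@lie_ooE _ _)) mixed ?oppr0 ].
Qed.

(** Here the mixed case is [gellmann R 3], whose opposite diagonal entries on the first two levels
    sum to zero. *)
Lemma jordan_unlisted j k : jordan_listed R j k = None ->
  jordan_listed R k j = None -> (1 <= j <= 8)%N -> (1 <= k <= 8)%N ->
  jordan_oo_mx (gellmann R j) (gellmann R k) = 0.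
Proof.
have offdiag a b : (forall i, a i i = 0) -> (forall i, b i i = 0) ->
    jordan_oo_mx a b = 0.
  move=> a0 b0; apply/matrixP => i l.
  by rewrite jordan_oo_mxE mxE !a0 !b0 addr0 !mul0r addr0 mulr0 if_same.
have mixed j' : (j' == 1%N) || (j' == 2%N) ->
    jordan_oo_mx (gellmann R j') (gellmann R 3) = 0.
  by case/orP=> /eqP ->; apply/matrixP => i l; rewrite jordan_oo_mxE !mxE;
    elim/ord3P: i; elim/ord3P: l;
    rewrite /= ?(mulr0, subrr, mul0r, add0r, addr0, addNr).
move: j k => [|[|[|[|[|[|[|[|[|j]]]]]]]]] [|[|[|[|[|[|[|[|[|k]]]]]]]]] //;
  move=> _ _ _ _;
  first [ by apply: offdiag => i; apply: gellmann_offdiag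
        | exact: mixed
        | by rewrite (joC (@jordan_oo_mxE _ _)) mixed ].
Qed.

Lemma expect_lie_gellmann j k : (1 <= j <= 8)%N -> (1 <= k <= 8)%N ->
  expect (lie_oo (gellmann R j) (gellmann R k)) = poisson_table j k.
Proof.
move=> hj hk; rewrite /poisson_table.
case jk: (poisson_listed R j k) => [f|]; first exact: expect_lie_listed.
case kj: (poisson_listed R k j) => [f|].
  by rewrite (br_skew (@lie_ooE _ _)) expectN (expect_lie_listed kj).
by rewrite lie_unlisted // expect0.
Qed.

Lemma expect_jordan_gellmann j k : (1 <= j <= 8)%N -> (1 <= k <= 8)%N ->
  expect (jordan_oo_mx (gellmann R j) (gellmann R k)) = jordan_table j k.
Proof.
move=> hj hk; rewrite /jordan_table.
case jk: (jordan_listed R j k) => [f|]; first exact: expect_jordan_listed.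
case kj: (jordan_listed R k j) => [f|].
  by rewrite (joC (@jordan_oo_mxE _ _)) (expect_jordan_listed kj).
by rewrite jordan_unlisted // expect0.
Qed.

End Tables.

(** * The two models *)

Section LimitAlgebraOfExpectations.
Variable R : realType.
Notation V := 'M[R[i]]_3.
Variables (L : V -> V) (kappa : R) (y : 'I_3 -> 'I_3 -> R).
Hypothesis kappa_gt0 : 0 < kappa.
Hypothesis y_skew : forall i j, y j i = - y i j.
Hypothesis LE : forall rho i j,
  L rho i j = decoherence_rate kappa y i j * rho i j.

Lemma limit_exists_LambdaD : limit_exists L (@LambdaD R).
Proof.
move=> xi alpha beta _ la lb.
exact: cvgP (pushforward_LambdaD_cvg kappa_gt0 y_skew LE la lb).
Qed.

Lemma limit_exists_RD : limit_exists L (@RD R).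
Proof.
move=> xi alpha beta _ la lb.
exact: cvgP (pushforward_RD_cvg kappa_gt0 y_skew LE la lb).
Qed.

(** On Hermitian matrices [expect] is real linear and carries the matrix products to the limit
    products, so each axiom is the image of a matrix identity; nested products require that
    Hermitian matrices be closed under both. *)
Lemma expectations_lie_jordan :
  is_lie_jordan (@expectations R) (poisson_oo L) (jordan_oo L).
Proof.
have brE := poisson_oo_expect kappa_gt0 y_skew LE.
have joE := jordan_oo_expect kappa_gt0 y_skew LE.
have br_in := br_herm (@lie_ooE R 3).
have jo_in := jo_herm (@jordan_oo_mxE R 3).
have lin_in k (a b : V) (ha : a \is hermsymmx) (hb : b \is hermsymmx) :=
  hermD (hermZ k ha) hb.
have expect_lin k (a b : V) :
    k *: expect a + expect b = expect (k%:C *: a + b).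
  by rewrite expectD expectZ.
have expectB (a b : V) : expect a - expect b = expect (a - b).
  by rewrite expectD expectN.
split.
- by exists 0; [exact: herm0|exact: expect0].
- move=> k _ _ [a ha <-] [b hb <-]; exists (k%:C *: a + b).
    exact: lin_in ha hb.
  by rewrite expect_lin.
- move=> _ _ [a ha <-] [b hb <-]; rewrite (brE _ _ ha hb).
  by exists (lie_oo a b); first exact: br_in ha hb.
- move=> _ _ [a ha <-] [b hb <-]; rewrite (joE _ _ ha hb).
  by exists (jordan_oo_mx a b); first exact: jo_in ha hb.
- move=> k _ _ _ [a ha <-] [b hb <-] [c hc <-].
  rewrite expect_lin (brE _ _ (lin_in k _ _ ha hb) hc).
  rewrite (brE _ _ ha hc) (brE _ _ hb hc) expect_lin.
  by rewrite (br_linl (@lie_ooE R 3)).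
- move=> _ _ [a ha <-] [b hb <-].
  by rewrite (brE _ _ ha hb) (brE _ _ hb ha) (br_skew (@lie_ooE R 3)) expectN.
- move=> _ _ _ [a ha <-] [b hb <-] [c hc <-].
  rewrite (brE _ _ ha hb) (brE _ _ hb hc) (brE _ _ hc ha).
  rewrite (brE _ _ ha (br_in _ _ hb hc)) (brE _ _ hb (br_in _ _ hc ha)).
  rewrite (brE _ _ hc (br_in _ _ ha hb)) -!expectD.
  by rewrite (br_jacobi (@lie_ooE R 3)) expect0.
- move=> k _ _ _ [a ha <-] [b hb <-] [c hc <-].
  rewrite expect_lin (joE _ _ (lin_in k _ _ ha hb) hc).
  rewrite (joE _ _ ha hc) (joE _ _ hb hc) expect_lin.
  by rewrite (jo_linl (@jordan_oo_mxE R 3)).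
- move=> _ _ [a ha <-] [b hb <-].
  by rewrite (joE _ _ ha hb) (joE _ _ hb ha) (joC (@jordan_oo_mxE R 3)).
- move=> _ _ [a ha <-] [b hb <-].
  have haa := jo_in _ _ ha ha.
  rewrite (joE _ _ ha hb) (joE _ _ ha ha) (joE _ _ (jo_in _ _ ha hb) haa).
  rewrite (joE _ _ hb haa) (joE _ _ ha (jo_in _ _ hb haa)).
  by rewrite (jo_jordan (@jordan_oo_mxE R 3)).
- move=> _ _ _ [a ha <-] [b hb <-] [c hc <-].
  rewrite (joE _ _ hb hc) (brE _ _ ha (jo_in _ _ hb hc)).
  rewrite (brE _ _ ha hb) (brE _ _ ha hc) (joE _ _ (br_in _ _ ha hb) hc).
  rewrite (joE _ _ hb (br_in _ _ ha hc)) -expectD.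
  by rewrite (br_derivation (@lie_ooE R 3) (@jordan_oo_mxE R 3)).
exists 1; first exact: oner_neq0.
suff associator f g h : expectations f -> expectations g -> expectations h ->
    jordan_oo L f (jordan_oo L g h) - jordan_oo L (jordan_oo L f g) h =
    poisson_oo L f (poisson_oo L g h) - poisson_oo L (poisson_oo L f g) h.
  by move=> f g h hf hg hh; rewrite expr1n scale1r; exact: associator.
move=> [a ha <-] [b hb <-] [c hc <-].
rewrite (joE _ _ hb hc) (joE _ _ ha hb) (brE _ _ hb hc) (brE _ _ ha hb).
rewrite (joE _ _ ha (jo_in _ _ hb hc)) (joE _ _ (jo_in _ _ ha hb) hc).
rewrite (brE _ _ ha (br_in _ _ hb hc)) (brE _ _ (br_in _ _ ha hb) hc).
apply: etrans (expectB _ _) (etrans _ (esym (expectB _ _))).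
by rewrite (br_jo_associator (@lie_ooE R 3) (@jordan_oo_mxE R 3)).
Qed.

Lemma poisson_oo_xcoord j k : (1 <= j <= 8)%N -> (1 <= k <= 8)%N ->
  poisson_oo L (xcoord j) (xcoord k) = poisson_table j k.
Proof.
move=> hj hk; rewrite -expect_lie_gellmann //.
exact: (poisson_oo_expect kappa_gt0 y_skew LE
  (gellmann_herm _ _) (gellmann_herm _ _)).
Qed.

Lemma jordan_oo_xcoord j k : (1 <= j <= 8)%N -> (1 <= k <= 8)%N ->
  jordan_oo L (xcoord j) (xcoord k) = jordan_table j k.
Proof.
move=> hj hk; rewrite -expect_jordan_gellmann //.
exact: (jordan_oo_expect kappa_gt0 y_skew LE
  (gellmann_herm _ _) (gellmann_herm _ _)).
Qed.

End LimitAlgebraOfExpectations.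

(** * Decay rates of the two models *)

Section ModelRates.
Variable R : realType.
Notation V := 'M[R[i]]_3.

(** The angles [pi / 3] and [2 pi / 3] are supplementary, so the duplication formula yields
    [(2c - 1)(c + 1) = 0] with [c > 0]. *)
Lemma cos_pi3 : cos (pi / 3) = 2^-1 :> R.
Proof.
have pi0 : 0 < (pi : R) := pi_gt0 R.
have c0 : 0 < cos (pi / 3) :> R by apply: cos_gt0_pihalf; lra.
have e : cos ((pi / 3) *+ 2) = - cos (pi / 3) :> R.
  have -> : (pi / 3) *+ 2 = pi - pi / 3 :> R by field.
  by rewrite cosB cospi sinpi; ring.
move: e; rewrite cos_mulr2n; move: (cos _) c0 => c c0 e.
have : (2 * c - 1) * (c + 1) = (c ^+ 2 *+ 2 - 1) + c by ring.
rewrite e addNr => /eqP; rewrite mulf_eq0 => /orP[] /eqP h; lra.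
Qed.

Lemma sqr_sin_pi3 : sin (pi / 3) ^+ 2 = 3 / 4 :> R.
Proof. by rewrite sin2cos2 cos_pi3; field. Qed.

Lemma cos_2pi3 : cos (2 * pi / 3) = - 2^-1 :> R.
Proof.
have -> : 2 * pi / 3 = (pi / 3) *+ 2 :> R by field.
by rewrite cos_mulr2n cos_pi3; field.
Qed.

Lemma sqr_sin_2pi3 : sin (2 * pi / 3) ^+ 2 = 3 / 4 :> R.
Proof. by rewrite sin2cos2 cos_2pi3; field. Qed.

(** For three positions the squared sine is 3/4 at distance 1 as well as 2, hence a common rate and
    no phase. *)
Lemma L_M_rate (gamma : R) rho i j : L_M gamma rho i j =
  decoherence_rate (3 * gamma) (fun _ _ : 'I_3 => 0) i j * rho i j.
Proof.
pose B : V := \matrix_(m, n) (rho m n *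
  (- (4 * gamma * sin (pi * (m%:R - n%:R) / 3%:R) ^+ 2))%:C).
have -> : L_M gamma rho = B.
  rewrite [RHS]matrix_sum_delta; apply: eq_bigr => m _; apply: eq_bigr => n _.
  by rewrite scalerA mxE.
rewrite mxE mulrC; congr (_ * _).
rewrite /decoherence_rate; have [<-|ij] := eqVneq i j.
    by rewrite subrr mulr0 mul0r sin0 expr0n mulr0 oppr0.
  suff -> : sin (pi * (i%:R - j%:R) / 3%:R) ^+ 2 = 3 / 4 :> R.
    by congr (_ +i* _); field.
  move: ij; elim/ord3P: i; elim/ord3P: j => //= _.
  + have -> : pi * (0%:R - 1%:R) / 3%:R = - (pi / 3) :> R by field.
    by rewrite sinN sqrrN sqr_sin_pi3.
  + have -> : pi * (0%:R - 2%:R) / 3%:R = - (2 * pi / 3) :> R by field.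
    by rewrite sinN sqrrN sqr_sin_2pi3.
  + have -> : pi * (1%:R - 0%:R) / 3%:R = (pi / 3) :> R by field.
    by rewrite sqr_sin_pi3.
  + have -> : pi * (1%:R - 2%:R) / 3%:R = - (pi / 3) :> R by field.
    by rewrite sinN sqrrN sqr_sin_pi3.
  + have -> : pi * (2%:R - 0%:R) / 3%:R = (2 * pi / 3) :> R by field.
    by rewrite sqr_sin_2pi3.
  have -> : pi * (2%:R - 1%:R) / 3%:R = (pi / 3) :> R by field.
  by rewrite sqr_sin_pi3.
Qed.

Lemma UE k i j : U R 3 k i j = (i == j)%:R * lambda R 3 ^- (k * i).
Proof.
rewrite /U summxE (bigD1 i) //= big1 ?addr0.
  by rewrite !mxE eqxx /= eq_sym mulrC.
by move=> l li; rewrite !mxE [i == l]eq_sym (negPf li) mulr0.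
Qed.

Definition L_P_eigenvalue (gamma_ : nat -> R) (i j : 'I_3) : R[i] :=
  - 3^-1 * \sum_(1 <= k < 3) (gamma_ k)%:C *
    (1 - lambda R 3 ^- (k * i) * conjc (lambda R 3 ^- (k * j))).

Lemma L_PE gamma_ rho i j :
  L_P gamma_ rho i j = L_P_eigenvalue gamma_ i j * rho i j.
Proof.
rewrite /L_P /L_P_eigenvalue mxE -mulrA; congr (_ * _).
rewrite summxE mulr_suml; apply: eq_bigr => k _.
rewrite !mxE -mulrA; congr (_ * _); rewrite mulrBl mul1r; congr (_ - _).
rewrite (bigD1 j) //= big1 ?addr0; last first.
  move=> l lj; rewrite !mxE UE [j == l]eq_sym (negPf lj) mul0r.
  by rewrite [X in _ * X](_ : _ = 0) ?mulr0 //; exact: conjc0.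
rewrite !mxE UE eqxx mul1r (bigD1 i) //= big1 ?addr0; last first.
  by move=> l li; rewrite UE eq_sym (negPf li) !mul0r.
by rewrite UE eqxx mul1r mulrAC.
Qed.

(** For [i != j] both phase factors are nontrivial cube roots of unity, of real part -1/2. So each
    [gamma_ k] is multiplied by a number of real part 3/2, and the prefactor -1/3 yields the
    rate. *)
Lemma L_P_rate gamma_ :
  let y i j := complex.Im (L_P_eigenvalue gamma_ i j) in
  (forall i j, y j i = - y i j) /\
  forall i j, L_P_eigenvalue gamma_ i j =
    decoherence_rate ((gamma_ 1%N + gamma_ 2%N) / 2) y i j.
Proof.
set sn : R := sin (2 * pi / 3).
have sn2 : sn ^+ 2 = 3 / 4 := sqr_sin_2pi3.
have lamE : lambda R 3 = (- 2^-1) +i* sn.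
  by rewrite /lambda cos_2pi3.
(* The inverse of [lambda], a primitive cube root of unity; [v] below is its conjugate and its
   square. *)
pose w : R[i] := (- 2^-1) -i* sn.
have lw : lambda R 3 * w = 1.
  by rewrite lamE /w; simpc; congr (_ +i* _); [move: sn2; lra|lra].
have lamV n : lambda R 3 ^- n = w ^+ n.
  have l0 : lambda R 3 != 0.
    by apply: contra_eq_neq lw => ->; rewrite mul0r eq_sym oner_eq0.
  by rewrite -exprVn; congr (_ ^+ _); apply: (mulfI l0); rewrite lw mulfV.
pose v : R[i] := (- 2^-1) +i* sn.
have ww : w * w = v.
  by rewrite /w /v; simpc; congr (_ +i* _); [move: sn2; lra|lra].
have vv : v * v = w.
  by rewrite /w /v; simpc; congr (_ +i* _); [move: sn2; lra|lra].
have wv : w * v = 1.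
  by rewrite /w /v; simpc; congr (_ +i* _); [move: sn2; lra|lra].
have cw : conjc w = v by rewrite /w /v /= opprK.
have cv : conjc v = w by [].
have [rw rv] : complex.Re w = - 2^-1 /\ complex.Re v = - 2^-1 by [].
(* An opaque 1, so that all three cube roots of unity are conjugated by the same rewriting. *)
have [u u1] : exists u : R[i], u = 1 by exists 1.
have cu : conjc u = u by rewrite u1 conjc1.
have w1E (i : 'I_3) : w ^+ (1 * i) = nth 0 [:: u; w; v] i.
  by rewrite u1; elim/ord3P: i; rewrite mul1n // expr2 ww.
have w2E (i : 'I_3) : w ^+ (2 * i) = nth 0 [:: u; v; w] i.
  by rewrite u1 exprM expr2 ww; elim/ord3P: i; rewrite // expr2 vv.
have i3 : (3^-1 : R[i]) = (3^-1)%:C by rewrite fmorphV rmorph_nat.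
have nuE i j : L_P_eigenvalue gamma_ i j = - (3^-1)%:C *
    ((gamma_ 1%N)%:C * (1 - w ^+ (1 * i) * conjc (w ^+ (1 * j))) +
     (gamma_ 2%N)%:C * (1 - w ^+ (2 * i) * conjc (w ^+ (2 * j)))).
  rewrite /L_P_eigenvalue -[index_iota 1 3]/[:: 1; 2]%N !big_cons big_nil addr0.
  by rewrite !lamV i3.
have conjcB (p q : R[i]) : conjc (p - q) = conjc p - conjc q by exact: rmorphB.
have conjcN (z : R[i]) : conjc (- z) = - conjc z by exact: rmorphN.
move=> y; split=> i j.
  have -> : y j i = complex.Im (conjc (L_P_eigenvalue gamma_ i j)).
    rewrite /y; congr complex.Im; rewrite !nuE conjcM conjcN conjc_real conjcD.
    rewrite !(conjcM _%:C) !conjc_real !conjcB !conjcM !conjcK conjc1.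
    by congr (_ * (_ * (1 - _) + _ * (1 - _))); rewrite mulrC.
  by rewrite /y; case: (L_P_eigenvalue _ _ _).
(* Off the diagonal only the real part needs proof, as [y] is the imaginary part by definition. *)
suff H : if i == j then L_P_eigenvalue gamma_ i j = 0
  else complex.Re (L_P_eigenvalue gamma_ i j) =
    - ((gamma_ 1%N + gamma_ 2%N) / 2).
  move: H; rewrite /decoherence_rate /y; case: eqP => // _ <-.
  by case: (L_P_eigenvalue _ _ _).
rewrite nuE !w1E !w2E; move: cw cv ww vv wv rw rv.
move: w v {lw lamV w1E w2E nuE} => w v cw cv ww vv wv rw rv.
have vw : v * w = 1 by rewrite mulrC.
elim/ord3P: i; elim/ord3P: j => /=;
  rewrite ?(cu, cw, cv) ?(ww, vv, wv, vw) ?u1 ?(mulr1, mul1r) ?subrr ?mulr0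
    ?addr0 ?mulr0 //.
all: case: w v rw rv {cw cv ww vv wv vw} => [a b] [c d] /= -> ->; simpc => /=.
all: by field.
Qed.

End ModelRates.

Theorem theorem5p7 (R : realType) (gamma : R) (gamma_ : nat -> R)
    (gamma_gt0 : 0 < gamma)
    (gamma__gt0 : forall k : nat, (1 <= k < 3)%N -> 0 < gamma_ k) :
  (forall L : 'M[R[i]]_3 -> 'M[R[i]]_3,
     L = @L_M R 3 gamma \/ L = @L_P R 3 gamma_ ->
     [/\ limit_exists L (@LambdaD R) /\ limit_exists L (@RD R),
         forall j k : nat, (1 <= j <= 8)%N -> (1 <= k <= 8)%N ->
           poisson_oo L (xcoord j) (xcoord k) = poisson_table j k,
         forall j k : nat, (1 <= j <= 8)%N -> (1 <= k <= 8)%N ->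
           jordan_oo L (xcoord j) (xcoord k) = jordan_table j k
       & is_lie_jordan (@expectations R) (poisson_oo L) (jordan_oo L)]) /\
  (forall f g : density R -> R,
     expectations f -> expectations g ->
     poisson_oo (@L_M R 3 gamma) f g = poisson_oo (@L_P R 3 gamma_) f g /\
     jordan_oo (@L_M R 3 gamma) f g = jordan_oo (@L_P R 3 gamma_) f g).
Proof.
have kM0 : 0 < 3 * gamma by rewrite mulr_gt0.
have kP0 : 0 < (gamma_ 1%N + gamma_ 2%N) / 2.
  by rewrite divr_gt0 // addr_gt0 // gamma__gt0.
have yM (i j : 'I_3) : 0 = - 0 :> R by rewrite oppr0.
have [yP nuP] := L_P_rate gamma_.
have LP rho i j : L_P gamma_ rho i j = decoherence_rate
    ((gamma_ 1%N + gamma_ 2%N) / 2)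
    (fun i j => complex.Im (L_P_eigenvalue gamma_ i j)) i j * rho i j.
  by rewrite -nuP L_PE.
have LM := L_M_rate gamma.
split=> [L [] -> | _ _ [a ha <-] [b hb <-]].
- split.
  + by split; [exact: limit_exists_LambdaD kM0 yM LM
              |exact: limit_exists_RD kM0 yM LM].
  + exact: poisson_oo_xcoord kM0 yM LM.
  + exact: jordan_oo_xcoord kM0 yM LM.
  + exact: expectations_lie_jordan kM0 yM LM.
- split.
  + by split; [exact: limit_exists_LambdaD kP0 yP LP
              |exact: limit_exists_RD kP0 yP LP].
  + exact: poisson_oo_xcoord kP0 yP LP.
  + exact: jordan_oo_xcoord kP0 yP LP.
  + exact: expectations_lie_jordan kP0 yP LP.
(* Both models yield [expect] of the same matrix, free of rates and phases. *)
split.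
  by rewrite (poisson_oo_expect kM0 yM LM ha hb)
    (poisson_oo_expect kP0 yP LP ha hb).
by rewrite (jordan_oo_expect kM0 yM LM ha hb)
  (jordan_oo_expect kP0 yP LP ha hb).
Qed.
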